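(* Let $M$ be a countable transitive model of $\mathsf{ZF}^-$. Then there is a partial order $\mathbb{P}$ that is definable over $M$ and does not satisfy the forcing theorem for atomic $\mathcal{L}_\in$-formulae over $M$ (that is, the forcing theorem over $M$ fails for at least one atomic $\mathcal{L}_\in$-formula).
   Context: We work in a model $\mathsf{V}$ of $\mathsf{ZFC}$. $\mathsf{ZF}^-$ denotes the axioms of $\mathsf{ZF}$ without the power set axiom and with Collection instead of Replacement. $\mathcal{L}_\in$ is the first-order language of set theory. ''Definable over $M$'' means first-order definable over $\langle M,\in\rangle$, parameters from $M$ being allowed; a partial order $\mathbb{P}$ is definable over $M$ if both its domain (a subset of $M$) and its relation $\leq_{\mathbb{P}}$ are definable over $M$. A filter $G$ on $\mathbb{P}$ is $\mathbb{P}$-generic over $M$ if it meets every dense subset of $\mathbb{P}$ that is definable over $M$. A $\mathbb{P}$-name is a set all of whose elements are of the form $\langle\tau,p\rangle$ with $\tau$ a $\mathbb{P}$-name and $p\in\mathbb{P}$; $M^{\mathbb{P}}$ is the collection of all $\mathbb{P}$-names in $M$. For a $\mathbb{P}$-generic filter $G$ let $\sigma^G=\{\tau^G\mid \exists p\in G\ \langle\tau,p\rangle\in\sigma\}$ and $M[G]=\{\sigma^G\mid\sigma\in M^{\mathbb{P}}\}$. Write $p\Vdash^M_{\mathbb{P}}\varphi(\sigma_0,\ldots,\sigma_{n-1})$ if $\varphi(\sigma_0^G,\ldots,\sigma_{n-1}^G)$ holds in $M[G]$ whenever $G$ is $\mathbb{P}$-generic over $M$ with $p\in G$. $\mathbb{P}$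 satisfies the forcing theorem for $\varphi$ over $M$ if (a) (definability lemma) the set $\{\langle p,\sigma_0,\ldots,\sigma_{n-1}\rangle\in\mathbb{P}\times M^{\mathbb{P}}\times\cdots\times M^{\mathbb{P}}\mid p\Vdash^M_{\mathbb{P}}\varphi(\sigma_0,\ldots,\sigma_{n-1})\}$ is definable over $M$, and (b) (truth lemma) for all $\sigma_0,\ldots,\sigma_{n-1}\in M^{\mathbb{P}}$ and every $\mathbb{P}$-generic filter $G$ over $M$ such that $\varphi(\sigma_0^G,\ldots,\sigma_{n-1}^G)$ holds in $M[G]$, there is $p\in G$ with $p\Vdash^M_{\mathbb{P}}\varphi(\sigma_0,\ldots,\sigma_{n-1})$. *)

(* Defs.v *)
From Stdlib Require Import Relation_Operators Transitive_Closure.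
From mathcomp Require Import all_boot.
From mathcomp Require Import boolp classical_sets functions cardinality.

Set Implicit Arguments.
Unset Strict Implicit.
Unset Printing Implicit Defensive.

(* The ambient universe V of sets: well-founded trees (Aczel), quotiented by
   bisimulation so that equality of sets is Leibniz equality.  The lemmas
   [V_ext] to [V_choice] below show that V satisfies the axioms of ZFC
   (Separation and Replacement for arbitrary classes).  Classes are terms of
   type [set V]. *)

Inductive tree : Type := Sup (A : Type) (f : A -> tree).

Definition tidx (t : tree) : Type := let: Sup A _ := t in A.
Definition tsub (t : tree) : tidx t -> tree :=
  let: Sup A f := t return tidx t -> tree in f.

Fixpoint bisim (s t : tree) : Prop :=
  let: Sup A f := s in let: Sup B g := t in
  (forall a, exists b, bisim (f a) (g b)) /\
  (forall b, exists a, bisim (f a) (g b)).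

Lemma bisim_refl t : bisim t t.
Proof. by elim: t => A f IH /=; split=> a; exists a. Qed.

Lemma bisim_sym s t : bisim s t -> bisim t s.
Proof.
elim: s t => A f IH [B g] /= [H1 H2]; split=> [b|a].
  by have [a /IH] := H2 b; exists a.
by have [b /IH] := H1 a; exists b.
Qed.

Lemma bisim_trans s t u : bisim s t -> bisim t u -> bisim s u.
Proof.
elim: s t u => A f IH [B g] [C h] /= [H1 H2] [K1 K2]; split=> [a|c].
  by have [b /IH ab] := H1 a; have [c /ab] := K1 b; exists c.
by have [b bc] := K2 c; have [a /IH ab] := H2 b; exists a; apply: ab.
Qed.

Definition V : Type := {c : set tree | exists t, c = bisim t}.

Definition cls (t : tree) : V := exist _ (bisim t) (ex_intro _ t erefl).
Definition repr (x : V) : tree := sval (cid (proj2_sig x)).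

Lemma cls_eq s t : cls s = cls t <-> bisim s t.
Proof.
split=> [[] E|st]; first by rewrite E; apply: bisim_refl.
rewrite /cls; apply: eq_exist; apply/funext => u; apply/propext; split.
  by apply: bisim_trans; apply: bisim_sym.
exact: bisim_trans.
Qed.

Lemma reprK x : cls (repr x) = x.
Proof.
rewrite /repr; case: x => c cP /=; case: cid => t /= ct.
by rewrite /cls; apply: eq_exist.
Qed.

(* Every set x is the family of its elements [el x i], i : idx x. *)
Definition idx (x : V) : Type := tidx (repr x).
Definition el (x : V) (i : idx x) : V := cls (tsub i).

Definition mem (x y : V) : Prop := exists i : idx y, x = el i.
Notation "x ∈ y" := (mem x y) (at level 70, no associativity).

Definition mkset (A : Type) (f : A -> V) : V := cls (Sup (fun a => repr (f a))).

Lemma mem_mkset (A : Type) (f : A -> V) x :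
  x ∈ mkset f <-> exists a, x = f a.
Proof.
have : bisim (repr (mkset f)) (Sup (fun a => repr (f a))).
  by apply/cls_eq; rewrite reprK.
rewrite /mem /el /idx; case: (repr (mkset f)) => B g /= [H1 H2]; split.
  move=> [b ->]; have [a ba] := H1 b.
  by exists a; rewrite -[RHS]reprK; apply/cls_eq.
move=> [a ->]; have [b ba] := H2 a.
by exists b; rewrite -[LHS]reprK; apply/esym/cls_eq.
Qed.

Lemma mem_el x (i : idx x) : el i ∈ x.
Proof. by exists i. Qed.

Lemma V_ext x y : (forall z, z ∈ x <-> z ∈ y) -> x = y.
Proof.
move=> xy; rewrite -[x]reprK -[y]reprK; apply/cls_eq.
move: xy; rewrite /mem /el /idx.
case: (repr x) (repr y) => [A f] [B g] /= xy; split=> [a|b].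
  have [b /cls_eq ab] : exists b, cls (f a) = cls (g b).
    by apply/xy; exists a.
  by exists b.
have [a /cls_eq ba] : exists a, cls (g b) = cls (f a).
  by apply/xy; exists b.
by exists a; apply: bisim_sym.
Qed.

Lemma mem_wf : well_founded mem.
Proof.
suff acc t : forall x, bisim (repr x) t -> Acc mem x.
  by move=> x; apply: (acc (repr x)); apply: bisim_refl.
elim: t => A f IH x xt; constructor=> y [i ->].
move: i xt; rewrite /el /idx; case: (repr x) => B g /= b [H1 _].
have [a ba] := H1 b; apply: (IH a); apply: bisim_trans ba.
by apply/cls_eq; rewrite reprK.
Qed.

Definition vempty : V := mkset (False_rect V).
Definition upair (x y : V) : V := mkset (fun b : bool => if b then x else y).
(* Kuratowski pair *)
Definition opair (x y : V) : V := upair (upair x x) (upair x y).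

Lemma V_empty x : ~ x ∈ vempty.
Proof. by move=> /mem_mkset[]. Qed.

Lemma V_pairing x y z : z ∈ upair x y <-> z = x \/ z = y.
Proof.
split=> [/mem_mkset[[] ->]|]; [by left|by right|].
by move=> [] ->; apply/mem_mkset; [exists true|exists false].
Qed.

Lemma V_replacement (x : V) (A : set V) (F : V -> V) :
  exists y, forall z, z ∈ y <-> exists u, [/\ u ∈ x, A u & z = F u].
Proof.
exists (mkset (fun i : {i : idx x | A (el i)} => F (el (sval i)))) => z.
split=> [/mem_mkset[[i Ai] ->]|[_ [[i ->] Ai ->]]].
  by exists (el i); split=> //; apply: mem_el.
by apply/mem_mkset; exists (exist _ i Ai).
Qed.

Lemma V_separation (x : V) (A : set V) :
  exists y, forall z, z ∈ y <-> z ∈ x /\ A z.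
Proof.
have [y yP] := V_replacement x A id; exists y => z; split.
  by move=> /yP[u [ux Au ->]].
by move=> [zx Az]; apply/yP; exists z.
Qed.

Lemma V_union x : exists y, forall z, z ∈ y <-> exists2 u, u ∈ x & z ∈ u.
Proof.
exists (mkset (fun p : {i : idx x & idx (el i)} => el (projT2 p))) => z.
split=> [/mem_mkset[[i j] ->]|[_ [i ->] [j ->]]].
  by exists (el i); apply: mem_el.
by apply/mem_mkset; exists (existT (fun i => idx (el i)) i j).
Qed.

Lemma V_powerset x :
  exists y, forall z, z ∈ y <-> forall u, u ∈ z -> u ∈ x.
Proof.
pose sub (Q : idx x -> Prop) := mkset (fun i : {i | Q i} => el (sval i)).
exists (mkset sub) => z; split=> [/mem_mkset[Q ->] u|zx].
  by move=> /mem_mkset[i ->]; apply: mem_el.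
apply/mem_mkset; exists (fun i => el i ∈ z); apply: V_ext => u.
split=> [uz|/mem_mkset[[i iz] ->]//]; have [i ui] := zx _ uz.
by apply/mem_mkset; move: uz; rewrite ui => iz; exists (exist _ i iz).
Qed.

Lemma V_infinity : exists w, vempty ∈ w /\
  forall x, x ∈ w -> exists2 y, y ∈ w & forall z, z ∈ y <-> z ∈ x \/ z = x.
Proof.
pose succ x := mkset (fun o : option (idx x) => oapp (@el x) x o).
exists (mkset (fun n => iter n succ vempty)); split.
  by apply/mem_mkset; exists 0.
move=> _ /mem_mkset[n ->]; exists (iter n.+1 succ vempty).
  by apply/mem_mkset; exists n.+1.
move=> z; split=> [/mem_mkset[[i|] ->]|].
- by left; apply: mem_el.
- by right.
- by move=> [[i ->]|->]; apply/mem_mkset; [exists (Some i)|exists None].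
Qed.

Lemma V_foundation x :
  x <> vempty -> exists2 y, y ∈ x & forall z, z ∈ y -> ~ z ∈ x.
Proof.
move=> x0; apply: contrapT => H; apply: x0; apply: V_ext => y.
split=> [yx|/V_empty//]; exfalso; move: yx.
by elim: y / (mem_wf y) => y _ IH yx; apply: H; exists y.
Qed.

Lemma V_choice x : (forall y, y ∈ x -> exists z, z ∈ y) ->
  (forall y y' z, y ∈ x -> y' ∈ x -> z ∈ y -> z ∈ y' -> y = y') ->
  exists c, forall y, y ∈ x -> exists! z, z ∈ y /\ z ∈ c.
Proof.
move=> ne dj; pose pick i := sval (cid (ne _ (@mem_el x i))).
have pickP i : pick i ∈ el i by rewrite /pick; case: cid.
pose c (y : V) (yx : y ∈ x) := pick (sval (cid yx)).
have cP y yx : @c y yx ∈ y.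
  by rewrite /c; case: (cid yx) => i /= ->; apply: pickP.
exists (mkset (fun i => c _ (@mem_el x i))) => _ [i ->].
exists (c _ (mem_el i)); split.
  by split; [apply: cP|apply/mem_mkset; exists i].
move=> z [zi /mem_mkset[j zj]]; rewrite zj in zi *.
have E : el i = el j by apply: dj zi (cP _ _); apply: mem_el.
by move: (mem_el i); rewrite E => H; rewrite (Prop_irrelevance H (mem_el j)).
Qed.

(* First-order formulae of set theory, with de Bruijn variables: in [FEx phi],
   variable 0 of phi is bound, and variable i.+1 of phi is the variable i of
   the context. *)
Inductive form : Type :=
  | FMem (i j : nat)
  | FEq (i j : nat)
  | FNot (phi : form)
  | FAnd (phi psi : form)
  | FEx (phi : form).

Definition atomic (phi : form) : bool :=
  match phi with FMem _ _ | FEq _ _ => true | _ => false end.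

(* the free variables of phi are among v_0, ..., v_(n-1) *)
Fixpoint fv_below (n : nat) (phi : form) : bool :=
  match phi with
  | FMem i j | FEq i j => (i < n) && (j < n)
  | FNot phi => fv_below n phi
  | FAnd phi psi => fv_below n phi && fv_below n psi
  | FEx phi => fv_below n.+1 phi
  end.

(* Satisfaction in the structure (D, ∈), where v_i is interpreted as the i-th
   entry of s (variables out of range, which do not occur when
   [fv_below (size s) phi], are read as the empty set). *)
Fixpoint sat (D : set V) (s : seq V) (phi : form) : Prop :=
  match phi with
  | FMem i j => nth vempty s i ∈ nth vempty s j
  | FEq i j => nth vempty s i = nth vempty s j
  | FNot phi => ~ sat D s phi
  | FAnd phi psi => sat D s phi /\ sat D s psi
  | FEx phi => exists2 x, D x & sat D (x :: s) phi
  end.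

Definition elts (x : V) : set V := [set y | y ∈ x]%classic.

Definition entries_in (D : set V) n (s : n.-tuple V) : Prop :=
  forall i, D (tnth s i).

Definition transitive_set (M : V) : Prop :=
  forall x y, y ∈ M -> x ∈ y -> x ∈ M.

(* (M, ∈) satisfies the axioms of ZF without Power Set and with Collection in
   place of Replacement; each field spells out the satisfaction in (M, ∈) of
   the axiom (or of all instances, with parameters ps, of the schema). *)
Record ZFminus_model (M : V) : Prop := {
  zf_extensionality : forall x y, x ∈ M -> y ∈ M ->
    (forall z, z ∈ M -> (z ∈ x <-> z ∈ y)) -> x = y;
  zf_foundation : forall x, x ∈ M -> (exists2 y, y ∈ M & y ∈ x) ->
    exists y, [/\ y ∈ M, y ∈ x & ~ exists2 z, z ∈ M & z ∈ x /\ z ∈ y];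
  zf_pairing : forall x y, x ∈ M -> y ∈ M ->
    exists2 u, u ∈ M & forall z, z ∈ M -> (z ∈ u <-> z = x \/ z = y);
  zf_union : forall x, x ∈ M ->
    exists2 u, u ∈ M & forall z, z ∈ M ->
      (z ∈ u <-> exists2 y, y ∈ M & y ∈ x /\ z ∈ y);
  zf_infinity : exists2 w, w ∈ M &
    (exists e, [/\ e ∈ M, e ∈ w & forall z, z ∈ M -> ~ z ∈ e]) /\
    (forall x, x ∈ M -> x ∈ w ->
       exists y, [/\ y ∈ M, y ∈ w &
         forall z, z ∈ M -> (z ∈ y <-> z ∈ x \/ z = x)]);
  zf_separation : forall (phi : form) m (ps : m.-tuple V) x,
    entries_in (elts M) ps -> x ∈ M ->
    exists2 u, u ∈ M & forall z, z ∈ M ->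
      (z ∈ u <-> z ∈ x /\ sat (elts M) (z :: ps) phi);
  zf_collection : forall (phi : form) m (ps : m.-tuple V) x,
    entries_in (elts M) ps -> x ∈ M ->
    (forall y, y ∈ M -> y ∈ x ->
       exists2 z, z ∈ M & sat (elts M) [:: y, z & ps] phi) ->
    exists2 u, u ∈ M & forall y, y ∈ M -> y ∈ x ->
      exists z, [/\ z ∈ M, z ∈ u & sat (elts M) [:: y, z & ps] phi]
}.

(* R is a subset of M^n and is first-order definable over (M, ∈) with
   parameters from M. *)
Definition definable (M : V) n (R : n.-tuple V -> Prop) : Prop :=
  exists (phi : form) m (ps : m.-tuple V), entries_in (elts M) ps /\
    forall s : n.-tuple V,
      R s <-> entries_in (elts M) s /\ sat (elts M) (s ++ ps) phi.

Definition definable_set (M : V) (A : set V) : Prop :=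
  definable M (fun s : 1.-tuple V => A (thead s)).

Definition definable_rel (M : V) (R : V -> V -> Prop) : Prop :=
  definable M (fun s : 2.-tuple V => R (tnth s ord0) (tnth s ord_max)).

Record poset : Type := Poset {
  dom : set V;
  ple : V -> V -> Prop;
  ple_dom : forall p q, ple p q -> dom p /\ dom q;
  ple_refl : forall p, dom p -> ple p p;
  ple_trans : forall p q r, ple p q -> ple q r -> ple p r;
  ple_anti : forall p q, ple p q -> ple q p -> p = q
}.

Definition definable_poset (M : V) (P : poset) : Prop :=
  definable_set M (dom P) /\ definable_rel M (ple P).

Definition dense (P : poset) (D : set V) : Prop :=
  (forall p, D p -> dom P p) /\
  (forall p, dom P p -> exists2 q, D q & ple P q p).

Record is_filter (P : poset) (G : set V) : Prop := {
  filter_dom : forall p, G p -> dom P p;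
  filter_nonempty : exists p, G p;
  filter_up : forall p q, G p -> ple P p q -> G q;
  filter_dir : forall p q, G p -> G q ->
    exists r, [/\ G r, ple P r p & ple P r q]
}.

Definition generic (M : V) (P : poset) (G : set V) : Prop :=
  is_filter P G /\
  forall D, dense P D -> definable_set M D -> exists2 p, G p & D p.

Inductive is_name (P : poset) (sigma : V) : Prop :=
  IsName of (forall z, z ∈ sigma ->
    exists tau p, [/\ z = opair tau p, is_name P tau & dom P p]).

(* the names in M *)
Definition names (M : V) (P : poset) : set V :=
  [set sigma | sigma ∈ M /\ is_name P sigma]%classic.

Lemma upair_inj x y z t : upair x y = upair z t ->
  (x = z /\ y = t) \/ (x = t /\ y = z).
Proof.
move=> E; have H u : (u = x \/ u = y) <-> (u = z \/ u = t).
  by rewrite -!V_pairing E.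
have [Hx Hy] : (x = z \/ x = t) /\ (y = z \/ y = t).
  by split; apply/H; [left|right].
have [Hz Ht] : (z = x \/ z = y) /\ (t = x \/ t = y).
  by split; apply/H; [left|right].
case: Hx Hy Hz Ht => [->|->] [->|->] [] ? [] ?; subst; by [left|right].
Qed.

Lemma opair_inj x y z t : opair x y = opair z t -> x = z /\ y = t.
Proof.
move=> /upair_inj[[/upair_inj E1 /upair_inj E2]|].
  by case: E1 E2 => [[-> _]|[-> _]] [[_ ->]|[<- <-]].
move=> [/upair_inj[[-> E1]|[-> E1]] /upair_inj[[E2 E3]|[E2 E3]]]; by subst.
Qed.

Definition name_child (tau sigma : V) : Prop := exists p, opair tau p ∈ sigma.

Lemma name_child_wf : well_founded name_child.
Proof.
move=> x; have := wf_clos_trans _ mem mem_wf x.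
elim=> {}x _ IH; constructor=> y [p yx]; apply: IH.
apply: (t_trans _ _ _ (upair y y)).
  by apply: t_step; apply/V_pairing; left.
apply: t_trans (t_step _ _ _ _ yx).
by apply: t_step; apply/V_pairing; left.
Qed.

Section Evaluation.
Variable G : set V.

(* the indices of the pairs (tau, p) in sigma with p in G *)
Definition active (sigma : V) : Type :=
  {i : idx sigma | exists tau, exists2 p, G p & el i = opair tau p}.

Definition active_name sigma (a : active sigma) : V := sval (cid (svalP a)).

Lemma active_nameP sigma (a : active sigma) :
  exists2 p, G p & el (sval a) = opair (active_name a) p.
Proof. by rewrite /active_name; case: cid. Qed.

Lemma active_name_child sigma (a : active sigma) :
  name_child (active_name a) sigma.
Proof. by have [p _ Ea] := active_nameP a; exists p; rewrite -Ea; apply: mem_el. Qed.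

(* sigma^G, by recursion on sigma; see [mem_eval] for the defining equation *)
Definition eval : V -> V :=
  Fix name_child_wf (fun _ => V)
    (fun sigma rec => mkset (fun a : active sigma =>
                               rec (active_name a) (active_name_child a))).

Lemma eval_eq sigma :
  eval sigma = mkset (fun a : active sigma => eval (active_name a)).
Proof.
rewrite {1}/eval Fix_eq // => x f g fg.
by congr mkset; apply/funext => a; apply: fg.
Qed.

Lemma mem_eval sigma x :
  x ∈ eval sigma <->
  exists tau, x = eval tau /\ exists2 p, G p & opair tau p ∈ sigma.
Proof.
rewrite eval_eq mem_mkset; split=> [[a ->]|[tau [-> [p Gp [i Ei]]]]].
  exists (active_name a); split=> //.
  by have [p Gp Ea] := active_nameP a; exists p; rewrite -?Ea //; apply: mem_el.
have Hi : exists tau, exists2 p, G p & el i = opair tau p.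
  by exists tau, p.
exists (exist _ i Hi); congr eval.
have [q _ /=] := active_nameP (exist _ i Hi : active sigma).
by rewrite -Ei => /opair_inj[].
Qed.

End Evaluation.

(* M[G] *)
Definition extension (M : V) (P : poset) (G : set V) : set V :=
  [set eval G sigma | sigma in names M P]%classic.

Definition forces (M : V) (P : poset) n (phi : form) (p : V)
    (sigma : n.-tuple V) : Prop :=
  forall G, generic M P G -> G p ->
    sat (extension M P G) [seq eval G tau | tau <- sigma] phi.

Definition definability_lemma (M : V) (P : poset) n (phi : form) : Prop :=
  definable M (fun s : n.+1.-tuple V =>
    let p := thead s in let sigma := [tuple of behead s] in
    [/\ dom P p, entries_in (names M P) sigma & forces M P phi p sigma]).

Definition truth_lemma (M : V) (P : poset) n (phi : form) : Prop :=
  forall sigma : n.-tuple V, entries_in (names M P) sigma ->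
  forall G, generic M P G ->
    sat (extension M P G) [seq eval G tau | tau <- sigma] phi ->
    exists2 p, G p & forces M P phi p sigma.

(* for formulae phi(v_0, ..., v_(n-1)) *)
Definition forcing_theorem (M : V) (P : poset) n (phi : form) : Prop :=
  definability_lemma M P n phi /\ truth_lemma M P n phi.

(* Main.v *)
Require Import Defs.
From mathcomp Require Import all_boot.
From mathcomp Require Import boolp classical_sets functions cardinality.

Set Implicit Arguments.
Unset Strict Implicit.
Unset Printing Implicit Defensive.

(* Force with partial maps p from omega to M with bounded domain, so that a
   generic filter yields a surjection f of omega onto M, and add for all i, j
   in omega a condition that acts as the Boolean value of f i not being in f j.
   Since set many conditions now speak about all of f, every formula phi with
   variables assigned to elements of omega has a name in M that evaluates to
   one of two fixed distinct sets according to the truth of phi in M under f: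
   a quantifier over M becomes a quantifier over omega, hence a set of names.
   If the forcing relation for v_0 = v_1 were definable, then so would be a
   relation having every definable subclass of M as a section, which Cantor's
   diagonal argument excludes. *)

(** * Satisfaction under total assignments, and renaming of variables *)

Notation env := (nat -> V).

Definition scons (x : V) (s : env) : env := fun i => if i is j.+1 then s j else x.
Definition shift (s : env) : env := fun i => s i.+1.

(** Assignments are total functions rather than lists, so that renamings and shifts of variables
    need no bookkeeping of lengths. *)
Fixpoint satf (D : set V) (s : env) (phi : form) : Prop :=
  match phi with
  | FMem i j => s i ∈ s j
  | FEq i j => s i = s j
  | FNot phi => ~ satf D s phi
  | FAnd phi psi => satf D s phi /\ satf D s psi
  | FEx phi => exists2 x, D x & satf D (scons x s) phi
  end.

Lemma sat_satf D s phi : sat D s phi <-> satf D (nth vempty s) phi.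
Proof.
elim: phi s => [i j|i j|phi IH|phi IH psi IH'|phi IH] s //=.
- by rewrite IH.
- by rewrite IH IH'.
suff E x : scons x (nth vempty s) = nth vempty (x :: s).
  by split=> -[x Dx h]; exists x => //; move: h; rewrite IH E.
by apply/funext; case.
Qed.

Definition up (r : nat -> nat) (i : nat) : nat := if i is j.+1 then (r j).+1 else 0.

Fixpoint ren (r : nat -> nat) (phi : form) : form :=
  match phi with
  | FMem i j => FMem (r i) (r j)
  | FEq i j => FEq (r i) (r j)
  | FNot phi => FNot (ren r phi)
  | FAnd phi psi => FAnd (ren r phi) (ren r psi)
  | FEx phi => FEx (ren (up r) phi)
  end.

Lemma satf_ren D r s phi : satf D s (ren r phi) <-> satf D (fun i => s (r i)) phi.
Proof.
elim: phi r s => [i j|i j|phi IH|phi IH psi IH'|phi IH] r s //=.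
- by rewrite IH.
- by rewrite IH IH'.
suff E x : (fun i => scons x s (up r i)) = scons x (fun i => s (r i)).
  by split=> -[x Dx h]; exists x => //; move: h; rewrite IH E.
by apply/funext; case.
Qed.

Fixpoint fv_bound (phi : form) : nat :=
  match phi with
  | FMem i j | FEq i j => maxn i.+1 j.+1
  | FNot phi => fv_bound phi
  | FAnd phi psi => maxn (fv_bound phi) (fv_bound psi)
  | FEx phi => (fv_bound phi).-1
  end.

Lemma satf_agree D s s' phi : (forall i, i < fv_bound phi -> s i = s' i) ->
  satf D s phi <-> satf D s' phi.
Proof.
elim: phi s s' => [i j|i j|phi IH|phi IH psi IH'|phi IH] s s' /= E.
- by rewrite !E // leq_max leqnn ?orbT.
- by rewrite !E // leq_max leqnn ?orbT.
- by rewrite (IH _ s').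
- by rewrite (IH _ s') ?(IH' _ s') // => i lt_i; apply: E; rewrite leq_max lt_i ?orbT.
have IHx x : satf D (scons x s) phi <-> satf D (scons x s') phi.
  by apply: IH => -[|i] //= lt_i; apply: E; case: (fv_bound phi) lt_i.
by split=> -[x Dx /IHx]; exists x.
Qed.

Definition vimage (a : V) (f : V -> V) : V := Defs.mkset (fun i : idx a => f (el i)).

Lemma mem_vimage a f z : z ∈ vimage a f <-> exists2 x, x ∈ a & z = f x.
Proof.
split=> [/mem_mkset[i ->]|[_ [i ->] ->]]; last by apply/mem_mkset; exists i.
by exists (el i) => //; apply: mem_el.
Qed.

Definition vcup (x y : V) : V :=
  Defs.mkset (fun i : idx x + idx y => match i with inl i => el i | inr i => el i end).

Lemma mem_vcup x y z : z ∈ vcup x y <-> z ∈ x \/ z ∈ y.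
Proof.
split=> [/mem_mkset[[i|i] ->]|[[i ->]|[i ->]]].
- by left; apply: mem_el.
- by right; apply: mem_el.
- by apply/mem_mkset; exists (inl i).
- by apply/mem_mkset; exists (inr i).
Qed.

(** * Predicates and functions definable over [M] *)

Section Definability.
Variable M : V.
Hypothesis trM : transitive_set M.
Hypothesis zfM : ZFminus_model M.

Definition in_M (s : env) : Prop := forall i, s i ∈ M.

Definition tval (s : env) (t : nat + V) : V :=
  match t with inl j => s j | inr a => a end.

Definition term_in_M (t : nat + V) : Prop := if t is inr a then a ∈ M else True.

(* Parameters are plugged in by c, which sends each variable of phi either to an
   entry of the environment or to an element of M. *)
Definition def_pred (R : env -> Prop) : Prop :=
  exists phi (c : nat -> nat + V), (forall i, term_in_M (c i)) /\
    forall s, in_M s -> (R s <-> satf (elts M) (fun i => tval s (c i)) phi).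

Lemma in_M_scons x s : x ∈ M -> in_M s -> in_M (scons x s).
Proof. by move=> Mx Ms [|i] //=. Qed.

Lemma in_M_shift s : in_M s -> in_M (shift s).
Proof. by move=> Ms i; apply: Ms. Qed.

Lemma scons_eta s : scons (s 0) (shift s) = s.
Proof. by apply/funext; case. Qed.

Lemma def_pred_equiv R R' : (forall s, in_M s -> (R s <-> R' s)) -> def_pred R -> def_pred R'.
Proof.
move=> E [phi [c [okc H]]]; exists phi, c; split=> // s oks.
by rewrite -E // H.
Qed.

Lemma def_pred_not R : def_pred R -> def_pred (fun s => ~ R s).
Proof.
move=> [phi [c [okc H]]]; exists (FNot phi), c; split=> // s oks /=.
by rewrite H.
Qed.

Lemma def_pred_and R R' : def_pred R -> def_pred R' -> def_pred (fun s => R s /\ R' s).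
Proof.
move=> [phi [c [okc H]]] [phi' [c' [okc' H']]].
(* The two formulae come with different parameter assignments. Moving their variables to the even
   and the odd positions lets one assignment serve both. *)
exists (FAnd (ren double phi) (ren (fun i => i.*2.+1) phi')).
exists (fun i => if odd i then c' i./2 else c i./2); split=> [i|s oks] /=.
  by case: ifP.
rewrite !satf_ren H // H' //.
have E1 : (fun i => tval s (if odd i.*2 then c' i.*2./2 else c i.*2./2)) =
  (fun i => tval s (c i)) by apply/funext => i; rewrite odd_double doubleK.
have E2 : (fun i => tval s (if odd i.*2.+1 then c' i.*2.+1./2 else c i.*2.+1./2)) =
  (fun i => tval s (c' i)) by apply/funext => i; rewrite /= odd_double uphalf_double.
by rewrite E1 E2.
Qed.

Lemma def_pred_or R R' : def_pred R -> def_pred R' -> def_pred (fun s => R s \/ R' s).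
Proof.
move=> dR dR'; apply: (@def_pred_equiv (fun s => ~ (~ R s /\ ~ R' s))) => [s _|].
  by rewrite not_andE !notK.
by apply: def_pred_not; apply: def_pred_and; apply: def_pred_not.
Qed.

Lemma def_pred_imp R R' : def_pred R -> def_pred R' -> def_pred (fun s => R s -> R' s).
Proof.
move=> dR dR'; apply: (@def_pred_equiv (fun s => ~ R s \/ R' s)) => [s _|].
  by rewrite implyE.
by apply: def_pred_or => //; apply: def_pred_not.
Qed.

Lemma def_pred_iff R R' : def_pred R -> def_pred R' -> def_pred (fun s => R s <-> R' s).
Proof. by move=> dR dR'; apply: def_pred_and; apply: def_pred_imp. Qed.

Lemma def_pred_ex (Q : V -> env -> Prop) : def_pred (fun s => Q (s 0) (shift s)) ->
  def_pred (fun s => exists2 x, x ∈ M & Q x s).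
Proof.
move=> [phi [c [okc H]]].
(* Several variables of [phi] may read entry 0 of the environment; all of them become the bound
   variable. The others move up by one and read the environment without its head. *)
pose r i := if c i is inl 0 then 0 else i.+1.
pose c' i := match c i with inl j => inl j.-1 | inr a => inr a end.
exists (FEx (ren r phi)), c'; split=> [i|s oks].
  by have := okc i; rewrite /c'; case: (c i).
have E x : (fun i => scons x (fun i => tval s (c' i)) (r i)) =
    (fun i => tval (scons x s) (c i)).
  by apply/funext => i; rewrite /r /c'; case cE: (c i) => [[|j]|a] //=; rewrite cE.
split=> /= -[x Mx h]; exists x => //.
  by rewrite satf_ren E -H //; apply: in_M_scons.
by move: h; rewrite satf_ren E -H //; apply: in_M_scons.
Qed.

Lemma def_pred_all (Q : V -> env -> Prop) : def_pred (fun s => Q (s 0) (shift s)) ->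
  def_pred (fun s => forall x, x ∈ M -> Q x s).
Proof.
move=> dQ; apply: (@def_pred_equiv (fun s => ~ exists2 x, x ∈ M & ~ Q x s)) => [s _|].
  split=> [h x Mx|h [x Mx]]; last by apply; apply: h.
  by apply: contrapT => nQ; apply: h; exists x.
by apply: def_pred_not; apply: def_pred_ex; apply: def_pred_not.
Qed.

Lemma def_pred_subst R (d : nat -> nat + V) : (forall i, term_in_M (d i)) -> def_pred R ->
  def_pred (fun s => R (fun i => tval s (d i))).
Proof.
move=> okd [phi [c [okc H]]]; exists phi.
exists (fun i => match c i with inl j => d j | inr a => inr a end); split=> [i|s oks].
  by have := okc i; case: (c i).
rewrite H => [|i]; last by have := okd i; case: (d i) => /=.
suff -> : (fun i => tval (fun j => tval s (d j)) (c i)) =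
  (fun i => tval s (match c i with inl j => d j | inr a => inr a end)) by [].
by apply/funext => i; case: (c i).
Qed.

Lemma def_pred_ren R r : def_pred R -> def_pred (fun s => R (fun i => s (r i))).
Proof. exact: (@def_pred_subst R (fun i => inl (r i))). Qed.

(** The language has no function symbols, so a function is handled through its graph: variable 0 is
    the value and the later variables are the arguments. *)
Definition def_fun (t : env -> V) : Prop :=
  (forall s, in_M s -> t s ∈ M) /\ def_pred (fun s => s 0 = t (shift s)).

Lemma def_fun_ren t r : def_fun t -> def_fun (fun s => t (fun i => s (r i))).
Proof.
move=> [Mt dt]; split=> [s oks|]; first by apply: Mt => i; apply: oks.
exact: (def_pred_ren (up r) dt).
Qed.

Lemma def_fun_shift t : def_fun t -> def_fun (fun s => t (shift s)).
Proof. exact: def_fun_ren. Qed.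

Lemma def_pred_eqv i j : def_pred (fun s => s i = s j).
Proof. by exists (FEq i j), inl. Qed.

Lemma def_pred_memv i j : def_pred (fun s => s i ∈ s j).
Proof. by exists (FMem i j), inl. Qed.

Lemma def_fun_var i : def_fun (fun s => s i).
Proof. by split=> [s|]; [apply|apply: def_pred_eqv]. Qed.

Lemma def_fun_cst a : a ∈ M -> def_fun (fun _ => a).
Proof.
move=> Ma; split=> //.
apply: (@def_pred_subst (fun s => s 0 = s 1) (fun i => if i is 0 then inl 0 else inr a)).
  by case.
exact: def_pred_eqv.
Qed.

(** Since [M] contains the value of [t], that value can be bound by a quantifier over [M] and pinned
    down by the graph. *)
Lemma def_pred_comp (R : V -> env -> Prop) t : def_fun t -> def_pred (fun s => R (s 0) (shift s)) ->
  def_pred (fun s => R (t s) s).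
Proof.
move=> [Mt dt] dR.
apply: (@def_pred_equiv (fun s => exists2 x, x ∈ M & x = t s /\ R x s)) => [s oks|].
  by split=> [[x Mx [-> //]]|h]; exists (t s) => //; apply: Mt.
by apply: def_pred_ex; apply: def_pred_and.
Qed.

Lemma def_pred_mem t u : def_fun t -> def_fun u -> def_pred (fun s => t s ∈ u s).
Proof.
move=> dt du; apply: (@def_pred_comp (fun x s => x ∈ u s)) => //.
apply: (@def_pred_comp (fun x s => s 0 ∈ x) (fun s => u (shift s))); first exact: def_fun_shift.
exact: def_pred_memv.
Qed.

Lemma def_pred_eq t u : def_fun t -> def_fun u -> def_pred (fun s => t s = u s).
Proof.
move=> dt du; apply: (@def_pred_comp (fun x s => x = u s)) => //.
by case: du.
Qed.

(** By extensionality the value is determined by its elements, and by transitivity these all lie in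
    [M]. A definition of the elements therefore yields one of the graph. *)
Lemma def_fun_set t (Q : V -> env -> Prop) : (forall s, in_M s -> t s ∈ M) ->
  (forall s z, in_M s -> z ∈ M -> (z ∈ t s <-> Q z s)) ->
  def_pred (fun s => Q (s 0) (shift s)) -> def_fun t.
Proof.
move=> Mt tQ dQ; split=> //.
apply: (@def_pred_equiv (fun s => forall z, z ∈ M -> (z ∈ s 0 <-> Q z (shift s)))).
  move=> s oks; split=> [h|-> z Mz]; last by apply: tQ => //; apply: in_M_shift.
  apply: V_ext => z; split=> [zs|zt].
    have Mz : z ∈ M by apply: trM zs; apply: oks.
    by apply/tQ; [apply: in_M_shift|..|apply/h].
  have Mz : z ∈ M by apply: trM zt; apply: Mt; apply: in_M_shift.
  by apply/h => //; apply/tQ; first apply: in_M_shift.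
apply: def_pred_all; apply: def_pred_iff; first exact: def_pred_memv.
exact: (def_pred_ren (fun i => match i with 0 => 0 | i.+1 => i.+2 end) dQ).
Qed.

(** * Closure of [M] under pairs and unions *)

Lemma M_upair x y : x ∈ M -> y ∈ M -> upair x y ∈ M.
Proof.
move=> Mx My; have [u Mu uP] := zf_pairing zfM Mx My.
suff -> : upair x y = u by [].
apply: V_ext => z; rewrite V_pairing; split=> [zxy|zu].
  by apply/uP => //; case: zxy => ->.
by apply/uP => //; apply: trM zu.
Qed.

Lemma M_opair x y : x ∈ M -> y ∈ M -> opair x y ∈ M.
Proof. by move=> Mx My; apply: M_upair; apply: M_upair. Qed.

Lemma M_opair_inv x y : opair x y ∈ M -> x ∈ M /\ y ∈ M.
Proof.
move=> Mxy; have Mu : upair x y ∈ M by apply: trM Mxy _; apply/V_pairing; right.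
by split; apply: trM Mu _; apply/V_pairing; [left|right].
Qed.

Lemma M_vcup x y : x ∈ M -> y ∈ M -> vcup x y ∈ M.
Proof.
move=> Mx My; have [u Mu uP] := zf_union zfM (M_upair Mx My).
suff -> : vcup x y = u by [].
apply: V_ext => z; rewrite mem_vcup; split=> [zxy|zu].
  have Mz : z ∈ M by case: zxy; apply: trM.
  apply/uP => //; case: zxy => zx.
    by exists x => //; split=> //; apply/V_pairing; left.
  by exists y => //; split=> //; apply/V_pairing; right.
have /uP := zu; case=> [|w _ []]; first exact: trM zu.
by move=> /V_pairing[->|->]; [left|right].
Qed.

Lemma def_fun_upair t u : def_fun t -> def_fun u -> def_fun (fun s => upair (t s) (u s)).
Proof.
move=> dt du; apply: (@def_fun_set _ (fun z s => z = t s \/ z = u s)) => [s oks|s z _ _|].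
- by apply: M_upair; [case: dt|case: du]; auto.
- exact: V_pairing.
by apply: def_pred_or; apply: def_pred_eq; (exact: def_fun_var || exact: def_fun_shift).
Qed.

Lemma def_fun_opair t u : def_fun t -> def_fun u -> def_fun (fun s => opair (t s) (u s)).
Proof. by move=> dt du; do !apply: def_fun_upair. Qed.

Lemma def_fun_vcup t u : def_fun t -> def_fun u -> def_fun (fun s => vcup (t s) (u s)).
Proof.
move=> dt du; apply: (@def_fun_set _ (fun z s => z ∈ t s \/ z ∈ u s)) => [s oks|s z _ _|].
- by apply: M_vcup; [case: dt|case: du]; auto.
- exact: mem_vcup.
by apply: def_pred_or; apply: def_pred_mem; (exact: def_fun_var || exact: def_fun_shift).
Qed.

Lemma nth_env_tuple n (s : env) i : i < n -> nth vempty [tuple s j | j < n] i = s i.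
Proof.
move=> lt_i; have := tnth_mktuple (fun j : 'I_n => s j) (Ordinal lt_i).
by rewrite (tnth_nth vempty).
Qed.

Definition prefix_env n (l : seq V) (s : env) : env :=
  fun i => if i < n then nth vempty l i else s (i - n).

(* The tail s of the environment is traded for the finite tuple ps because only
   finitely many variables occur in a formula. *)
Lemma def_pred_sat R n s : def_pred R -> in_M s ->
  exists phi m (ps : m.-tuple V), entries_in (elts M) ps /\
    forall l, size l = n -> (forall i, i < n -> nth vempty l i ∈ M) ->
      (sat (elts M) (l ++ ps) phi <-> R (prefix_env n l s)).
Proof.
move=> [phi [c [okc H]]] oks; set b := fv_bound phi.
(* A variable that reads an entry of [l] is renamed to the position of that entry. Any other
   variable i gets the slot n + i, which holds the parameter [pv i]. *)
pose r i := if c i is inl j then if j < n then j else n + i else n + i.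
pose pv i := match c i with inl j => s (j - n) | inr a => a end.
exists (ren r phi), b, [tuple pv i | i < b]; split=> [i|l sl okl].
  by rewrite /elts /= tnth_mktuple /pv; have := okc i; case: (c i) => //= j _; apply: oks.
rewrite sat_satf satf_ren H => [|i]; last first.
  by rewrite /prefix_env; case: ifP => // lt_i; apply: okl.
apply: satf_agree => i lt_i.
have pE : nth vempty (l ++ [tuple pv j | j < b]) (n + i) = pv i.
  rewrite nth_cat sl ltnNge leq_addr /= addKn.
  exact: nth_env_tuple.
move: pE; rewrite /r /pv /prefix_env /=; case: (c i) => [j|a] //=.
by case: ifP => // lt_j _; rewrite nth_cat sl lt_j.
Qed.

(** * Separation and Replacement in [M], and comparison with [definable] *)

Lemma M_separation (Q : V -> env -> Prop) s a : def_pred (fun s => Q (s 0) (shift s)) ->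
  in_M s -> a ∈ M -> exists2 u, u ∈ M & forall z, z ∈ u <-> z ∈ a /\ Q z s.
Proof.
move=> dQ oks Ma; have [phi [m [ps [okps psP]]]] := def_pred_sat 1 dQ oks.
have [u Mu uP] := zf_separation zfM phi okps Ma.
have E z : z ∈ M -> (sat (elts M) (z :: ps) phi <-> Q z s).
  move=> Mz; rewrite (psP [:: z]) // => [|[|] //].
  suff -> : shift (prefix_env 1 [:: z] s) = s by [].
  by apply/funext => i; rewrite /shift /prefix_env /= subn1.
exists u => // z; split=> [zu|[za Qz]].
  have Mz := trM Mu zu; have [za /E-/(_ Mz)] := (uP z Mz).1 zu.
  by split.
have Mz := trM Ma za; by apply/uP => //; split=> //; apply/E.
Qed.

(** This is Replacement for definable functions: Collection gives a set in [M] containing all the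
    values, and Separation removes everything else. *)
Lemma M_vimage (t : V -> env -> V) s a : def_fun (fun s => t (s 0) (shift s)) ->
  in_M s -> a ∈ M -> vimage a (fun x => t x s) ∈ M.
Proof.
move=> dt oks Ma; have [Mt' gt] := dt.
have Mt x : x ∈ M -> t x s ∈ M.
  by move=> Mx; apply: (Mt' (scons x s)); apply: in_M_scons.
pose R (s : env) := s 1 = t (s 0) (shift (shift s)).
have dR : def_pred R.
  (* The graph lists the value before the argument, Collection the argument before the value; hence
     the swap. *)
  exact: (def_pred_ren (fun i => match i with 0 => 1 | 1 => 0 | _ => i end) gt).
have [phi [m [ps [okps psP]]]] := def_pred_sat 2 dR oks.
have E x y : x ∈ M -> y ∈ M -> (sat (elts M) [:: x, y & ps] phi <-> y = t x s).
  move=> Mx My; rewrite (psP [:: x; y]) // => [|[|[|]] //].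
  rewrite /R; suff -> : shift (shift (prefix_env 2 [:: x; y] s)) = s by [].
  by apply/funext => i; rewrite /shift /prefix_env /= subn2.
have [y My ya|u Mu uP] := zf_collection zfM (phi := phi) okps Ma.
  by exists (t y s); [apply: Mt|apply/E => //; apply: Mt].
pose Q z (s' : env) := exists2 x, x ∈ M & x ∈ a /\ z = t x s'.
have dQ : def_pred (fun s' => Q (s' 0) (shift s')).
  apply: (@def_pred_ex (fun x s' => x ∈ a /\ s' 0 = t x (shift s'))); apply: def_pred_and.
    by apply: def_pred_mem; [exact: def_fun_var|exact: def_fun_cst].
  exact: dR.
have [w Mw wP] := M_separation (Q := Q) dQ oks Mu.
suff -> : vimage a (fun x => t x s) = w by [].
apply: V_ext => z; rewrite mem_vimage wP; split=> [[x xa ->]|[_ [x _ [xa ->]]]].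
  have Mx := trM Ma xa; have [y [My yu /(E _ _ Mx My) yE]] := uP x Mx xa.
  by rewrite -yE; split=> //; exists x.
by exists x.
Qed.

Lemma def_fun_vimage (t : V -> env -> V) a : def_fun a -> def_fun (fun s => t (s 0) (shift s)) ->
  def_fun (fun s => vimage (a s) (fun x => t x s)).
Proof.
move=> da dt; have [Mt gt] := dt.
apply: (@def_fun_set _ (fun z s => exists2 x, x ∈ M & x ∈ a s /\ z = t x s)) => [s oks|s z oks Mz|].
- by apply: M_vimage => //; apply: (proj1 da).
- rewrite mem_vimage; split=> [[x xa ->]|[x _ [xa ->]]]; exists x => //.
  by apply: trM xa; apply: (proj1 da).
apply: (@def_pred_ex (fun x s => x ∈ a (shift s) /\ s 0 = t x (shift s))); apply: def_pred_and.
  by apply: def_pred_mem; [exact: def_fun_var|exact: (def_fun_ren (fun i => i.+2) da)].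
exact: (def_pred_ren (fun i => match i with 0 => 1 | 1 => 0 | _ => i end) gt).
Qed.

Lemma M_empty : vempty ∈ M.
Proof.
have [w Mw [[e [Me _ eP]] _]] := zf_infinity zfM.
suff -> : vempty = e by [].
apply: V_ext => z; split=> [/V_empty //|ze].
by case: (eP z) => //; apply: trM ze.
Qed.

Lemma def_pred_definable R n : def_pred R ->
  definable M (fun s : n.-tuple V => entries_in (elts M) s /\ R (nth vempty s)).
Proof.
(* The constant environment agrees with the default value of [nth] past the end of a tuple. *)
move=> dR; have oks : in_M (fun=> vempty) by move=> i; apply: M_empty.
have [phi [m [ps [okps psP]]]] := def_pred_sat n dR oks.
exists phi, m, ps; split=> // s.
suff E : entries_in (elts M) s -> (R (nth vempty s) <-> sat (elts M) (s ++ ps) phi).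
  by split=> -[Ms /(E Ms)].
move=> Ms; rewrite psP ?size_tuple // => [|i lt_i]; last first.
  by have := Ms (Ordinal lt_i); rewrite (tnth_nth vempty).
suff -> : prefix_env n s (fun=> vempty) = nth vempty s by [].
apply/funext => i; rewrite /prefix_env; case: ltnP => // le_i.
by rewrite nth_default // size_tuple.
Qed.

Lemma definable_pred n (R : n.-tuple V -> Prop) (R' : env -> Prop) : definable M R ->
  (forall s, in_M s -> (R' s <-> R [tuple s i | i < n])) -> def_pred R'.
Proof.
move=> [phi [m [ps [okps H]]]] RR'.
exists phi, (fun i => if i < n then inl i else inr (nth vempty ps (i - n))).
split=> [i|s oks].
  case: ifP => //= _; have [lt_i|le_i] := ltnP (i - n) m; last first.
    by rewrite nth_default ?size_tuple //; apply: M_empty.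
  by have := okps (Ordinal lt_i); rewrite (tnth_nth vempty).
rewrite RR' // H.
have -> : sat (elts M) ([tuple s i | i < n] ++ ps) phi <->
   satf (elts M) (fun i => tval s (if i < n then inl i else inr (nth vempty ps (i - n)))) phi.
  rewrite sat_satf; apply: satf_agree => i _; rewrite nth_cat size_tuple.
  by case: ifP => //= lt_i; rewrite -[RHS](nth_env_tuple _ lt_i).
split=> [[_ h]|h] //; split=> // i; rewrite /elts /= tnth_mktuple; exact: oks.
Qed.

Lemma def_pred_M t : def_fun t -> def_pred (fun s => t s ∈ M).
Proof.
move=> dt; apply: (@def_pred_equiv (fun s => t s = t s)) => [s oks|]; last exact: def_pred_eq.
by split=> // _; apply: (proj1 dt).
Qed.

(** Definability is read off the syntax: the outermost symbol selects the closure lemma, and the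
    claims that a parameter is in [M] are taken from the context. *)
Ltac solve_def := repeat (cbv beta delta [shift]; first
  [ assumption
  | match goal with
    | |- def_pred (fun s => ~ _) => apply def_pred_not
    | |- def_pred (fun s => _ /\ _) => apply def_pred_and
    | |- def_pred (fun s => _ \/ _) => apply def_pred_or
    | |- def_pred (fun s => _ <-> _) => apply def_pred_iff
    | |- def_pred (fun s => forall x, x ∈ _ -> _) => apply def_pred_all
    | |- def_pred (fun s => exists2 x, x ∈ _ & _) => apply def_pred_ex
    | |- def_pred (fun s => _ -> _) => apply def_pred_imp
    | |- def_pred (fun s => _ ∈ M) => apply def_pred_M
    | |- def_pred (fun s => _ ∈ _) => apply def_pred_mem
    | |- def_pred (fun s => _ = _) => apply def_pred_eq
    | |- def_fun (fun s => s _) => apply def_fun_var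
    | |- def_fun (fun s => opair _ _) => apply def_fun_opair
    | |- def_fun (fun s => upair _ _) => apply def_fun_upair
    | |- def_fun (fun s => vcup _ _) => apply def_fun_vcup
    | |- def_fun (fun _ => _) => apply def_fun_cst
    end ]).

(** * The set of natural numbers belongs to [M] *)

Definition vsucc (x : V) : V := vcup x (upair x x).

Lemma mem_vsucc x z : z ∈ vsucc x <-> z ∈ x \/ z = x.
Proof. by rewrite mem_vcup V_pairing; split; tauto. Qed.

Fixpoint num (n : nat) : V := if n is m.+1 then vsucc (num m) else vempty.

Definition omega : V := Defs.mkset num.

Lemma mem_omega x : x ∈ omega <-> exists n, x = num n.
Proof. exact: mem_mkset. Qed.

Lemma mem_num x n : x ∈ num n <-> exists2 i, i < n & x = num i.
Proof.
elim: n => [|n IH] /=; first by split=> [/V_empty|[]].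
rewrite mem_vsucc IH; split=> [[[i lt_i ->]|->]|[i]].
- by exists i => //; apply: ltnW.
- by exists n.
- by rewrite ltnS leq_eqVlt => /orP[/eqP-> ->|lt_i ->]; [right|left; exists i].
Qed.

Lemma mem_irrefl x : ~ x ∈ x.
Proof. by elim: x / (mem_wf x) => x _ IH xx; apply: (IH x). Qed.

Lemma num_inj : injective num.
Proof.
have lt_num i j : i < j -> num i <> num j.
  by move=> lt_i E; apply: (@mem_irrefl (num j)); rewrite -{1}E; apply/mem_num; exists i.
move=> i j E; case: (ltngtP i j) => // /lt_num; first by [].
by move/(_ (esym E)).
Qed.

Lemma M_omega : omega ∈ M.
Proof.
have [w Mw [[e [Me ew eP]] sw]] := zf_infinity zfM.
have oks : in_M (fun=> vempty) by move=> i; apply: M_empty.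
have M0 := M_empty.
have numw n : num n ∈ w.
  elim: n => [|n nw] /=.
    suff -> : vempty = e by [].
    apply: V_ext => z; split=> [/V_empty //|ze].
    by case: (eP z) => //; apply: trM ze.
  have [y [My yw yP]] := sw _ (trM Mw nw) nw.
  suff -> : vsucc (num n) = y by [].
  apply: V_ext => z; rewrite mem_vsucc; split=> [zn|zy]; last by apply/yP => //; apply: trM zy.
  by apply/yP => //; case: zn => [zn|->]; [exact: trM (trM Mw nw) zn|exact: trM Mw nw].
(* The witness [w] of Infinity may be too large. Separation cuts it down to [o], the part lying in
   every inductive set of [M]. *)
pose ind u := vempty ∈ u /\ forall x, x ∈ M -> x ∈ u -> vsucc x ∈ u.
have dind : def_pred (fun s => forall u, u ∈ M -> ind u -> s 0 ∈ u).
  by rewrite /ind /vsucc; solve_def.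
have [o Mo oP] := M_separation (Q := fun z _ => forall u, u ∈ M -> ind u -> z ∈ u) dind oks Mw.
have numo n : num n ∈ o.
  apply/oP; split=> // u Mu [u0 uS]; elim: n => [|n IH] //=.
  by apply: uS => //; apply: trM (numw n).
suff -> : omega = o by [].
apply: V_ext => x; rewrite mem_omega; split=> [[n ->] //|].
(* By induction on membership all elements of [x] that lie in [o] are numerals. If [x] were not a
   numeral, it would be no successor of an element of [o], so [o] without [x] would still be
   inductive, contradicting the choice of [o]. *)
elim: x / (mem_wf x) => x _ IH xo; apply: contrapT => xn.
have Mx : x ∈ M by apply: trM xo.
have dx : def_pred (fun s => s 0 <> x) by solve_def.
have [u Mu uP] := M_separation (Q := fun z _ => z <> x) dx oks Mo.
have : x ∈ u; last by move=> /uP[].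
have [_] := (oP x).1 xo; apply=> //; split.
  by apply/uP; split=> [|E]; [exact: (numo 0)|case: xn; exists 0].
move=> y My /uP[yo _]; apply/uP; split.
  apply/oP; split=> [|v Mv indv].
    have [yw _] := (oP y).1 yo; have [y' [My' y'w y'P]] := sw _ My yw.
    suff -> : vsucc y = y' by [].
    apply: V_ext => z; rewrite mem_vsucc; split=> [zn|zy]; last by apply/y'P => //; apply: trM zy.
    by apply/y'P => //; case: zn => [zn|->] //; apply: trM zn.
  by have [_ vS] := indv; apply: vS => //; have [_] := (oP y).1 yo; apply.
move=> E; have yx : y ∈ x by rewrite -E; apply/mem_vsucc; right.
by have [n En] := IH y yx yo; apply: xn; exists n.+1; rewrite -E En.
Qed.

Lemma M_num n : num n ∈ M.
Proof. by apply: (trM M_omega); apply/mem_omega; exists n. Qed.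

(** * The partial order *)

Definition one : V := upair vempty vempty.

Lemma M_one : one ∈ M.
Proof. by apply: M_upair; apply: M_empty. Qed.

Lemma empty_neq_one : vempty <> one.
Proof. by move=> E; apply: (@V_empty vempty); rewrite {2}E V_pairing; left. Qed.

(** The tags [vempty] and [one] keep the partial maps apart from the added conditions. With f the
    generic map, [notin_cond i j] stands for the statement that f i is not in f j. *)
Definition fun_cond (p : V) : V := opair vempty p.
Definition notin_cond (i j : V) : V := opair one (opair i j).

Lemma fun_cond_inj p q : fun_cond p = fun_cond q -> p = q.
Proof. by move=> /opair_inj[]. Qed.

Lemma notin_cond_inj i j i' j' : notin_cond i j = notin_cond i' j' -> i = i' /\ j = j'.
Proof. by move=> /opair_inj[_ /opair_inj]. Qed.

Lemma fun_cond_neq p i j : fun_cond p <> notin_cond i j.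
Proof. by move=> /opair_inj[/empty_neq_one]. Qed.

(* Only the pairs in p matter: p may also have other elements. *)
Definition pfun (p : V) : Prop :=
  p ∈ M /\
  (forall i, i ∈ M -> forall x, x ∈ M -> forall y, y ∈ M ->
     opair i x ∈ p -> opair i y ∈ p -> x = y) /\
  exists2 n, n ∈ M & n ∈ omega /\
    forall i, i ∈ M -> forall x, x ∈ M -> opair i x ∈ p -> i ∈ n.

(* Negated membership, because it can be forced for all i and j, even i = j. *)
Definition notin_at (p i j : V) : Prop :=
  exists2 x, x ∈ M & exists2 y, y ∈ M & opair i x ∈ p /\ opair j y ∈ p /\ ~ x ∈ y.

Definition domP (z : V) : Prop :=
  (exists2 p, p ∈ M & pfun p /\ z = fun_cond p) \/
  (exists2 i, i ∈ M & exists2 j, j ∈ M & i ∈ omega /\ j ∈ omega /\ z = notin_cond i j).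

(** An added condition is never below a map, only above the maps that already decide its statement
    positively. The maps thus remain dense, and the added conditions in a generic filter are
    determined by f. *)
Definition leP (z w : V) : Prop :=
  (domP z /\ z = w) \/
  (exists2 p, p ∈ M & exists2 q, q ∈ M & pfun p /\ pfun q /\
     (forall x, x ∈ M -> x ∈ q -> x ∈ p) /\ z = fun_cond p /\ w = fun_cond q) \/
  (exists2 p, p ∈ M & exists2 i, i ∈ M & exists2 j, j ∈ M &
     pfun p /\ i ∈ omega /\ j ∈ omega /\ notin_at p i j /\ z = fun_cond p /\ w = notin_cond i j).

Lemma def_pred_domP t : def_fun t -> def_pred (fun s => domP (t s)).
Proof.
move=> dt; apply: (@def_pred_comp (fun x s => domP x)) => //.
have ? := M_omega; have ? := M_empty; have ? := M_one.
rewrite /domP /pfun /fun_cond /notin_cond; solve_def.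
Qed.

Lemma def_pred_leP : def_pred (fun s => leP (s 0) (s 1)).
Proof.
have ? := M_omega; have ? := M_empty; have ? := M_one.
rewrite /leP; apply: def_pred_or; first by apply: def_pred_and; [apply: def_pred_domP|]; solve_def.
by rewrite /pfun /notin_at /fun_cond /notin_cond; solve_def.
Qed.

Lemma domP_M z : domP z -> z ∈ M.
Proof.
case=> [[p Mp [_ ->]]|[i Mi [j Mj [_ [_ ->]]]]].
  by apply: M_opair => //; apply: M_empty.
by apply: M_opair; [apply: M_one|apply: M_opair].
Qed.

Lemma leP_dom z w : leP z w -> domP z /\ domP w.
Proof.
case=> [[dz <-] //|[[p Mp [q Mq [fp [fq [_ [-> ->]]]]]]|]].
  by split; left; [exists p|exists q].
move=> [p Mp [i Mi [j Mj [fp [iw [jw [_ [-> ->]]]]]]]].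
by split; [left; exists p|right; exists i => //; exists j].
Qed.

Lemma leP_refl z : domP z -> leP z z.
Proof. by left. Qed.

Lemma leP_A z p : leP z (fun_cond p) ->
  exists q, [/\ pfun q, z = fun_cond q & forall x, x ∈ p -> x ∈ q].
Proof.
case=> [[dz E]|[[q Mq [p' Mp [fq [fp [pq [-> /fun_cond_inj->]]]]]]|]]; last 1 first.
- by move=> [q _ [i _ [j _ [_ [_ [_ [_ [_ /fun_cond_neq]]]]]]]].
- exists p; case: dz E => [[q Mq [fq ->]] E|[i _ [j _ [_ [_ ->]]]] /esym/fun_cond_neq //].
  by split=> //; move: fq; rewrite (fun_cond_inj E).
by exists q; split=> // x xp; apply: pq => //; apply: trM xp.
Qed.

Lemma leP_B z i j : leP z (notin_cond i j) ->
  z = notin_cond i j \/ exists p, [/\ pfun p, z = fun_cond p & notin_at p i j].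
Proof.
case=> [[_ ->]|[[p _ [q _ [_ [_ [_ [_ /esym/fun_cond_neq]]]]]] //|]]; first by left.
move=> [p Mp [i' _ [j' _ [fp [_ [_ [H [-> /notin_cond_inj[-> ->]]]]]]]]].
by right; exists p.
Qed.

Lemma pfun_M p : pfun p -> p ∈ M.
Proof. by case. Qed.

Lemma leP_AA p q : pfun p -> pfun q -> (forall x, x ∈ q -> x ∈ p) -> leP (fun_cond p) (fun_cond q).
Proof.
move=> fp fq qp; right; left.
by exists p; [exact: pfun_M|exists q; [exact: pfun_M|do 2!split=> //; split=> [x _|//]; apply: qp]].
Qed.

Lemma leP_AB p i j : pfun p -> i ∈ omega -> j ∈ omega -> notin_at p i j ->
  leP (fun_cond p) (notin_cond i j).
Proof.
move=> fp iw jw H; right; right.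
exists p; first exact: pfun_M.
by exists i; [apply: (trM M_omega)|exists j; [apply: (trM M_omega)|]].
Qed.

(** The mixed case works because [notin_at] only asks for certain pairs in the map and so passes to
    larger maps. *)
Lemma leP_trans x y z : leP x y -> leP y z -> leP x z.
Proof.
move=> xy yz; have [dy _] := leP_dom yz; have [_ dz] := leP_dom yz.
case: dy => [[p Mp [fp E]]|[i Mi [j Mj [iw [jw E]]]]]; subst y; last first.
  case: yz => [[_ <-] //|[[p _ [q _ [_ [_ [_ [/esym/fun_cond_neq]]]]]] //|]].
  by move=> [p _ [? _ [? _ [_ [_ [_ [_ [/esym/fun_cond_neq]]]]]]]].
have [q [fq -> pq]] := leP_A xy.
case: dz => [[r Mr [fr E]]|[i Mi [j Mj [iw [jw E]]]]]; subst z.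
  have [p' [_ /fun_cond_inj <- rp]] := leP_A yz.
  by apply: leP_AA => // t /rp/pq.
case: (leP_B yz) => [/fun_cond_neq //|[p' [_ /fun_cond_inj <- [u Mu [v Mv [pu [pv uv]]]]]]].
by apply: leP_AB => //; exists u => //; exists v => //; do !split => //; apply: pq.
Qed.

Lemma leP_anti x y : leP x y -> leP y x -> x = y.
Proof.
move=> xy yx; have [dx dy] := leP_dom xy.
case: dy => [[p Mp [fp E]]|[i Mi [j Mj [iw [jw E]]]]]; subst y.
  have [q [fq E pq]] := leP_A xy; subst x.
  have [p' [_ /fun_cond_inj <- qp]] := leP_A yx.
  by congr fun_cond; apply: V_ext => z; split=> [/qp|/pq].
case: (leP_B xy) => [//|[p [_ E _]]]; subst x.
by have [q [_ /esym/fun_cond_neq]] := leP_A yx.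
Qed.

Definition collapse_poset : poset := Poset leP_dom leP_refl leP_trans leP_anti.

Lemma collapse_poset_definable : definable_poset M collapse_poset.
Proof.
split.
  have [phi [m [ps [okps H]]]] := @def_pred_definable _ 1 (def_pred_domP (def_fun_var 0)).
  exists phi, m, ps; split=> // s; rewrite -H /= /thead (tnth_nth vempty) /=.
  split=> [ds|[] //]; split=> // i; rewrite (ord1 i) /elts /= (tnth_nth vempty) /=.
  exact: domP_M.
have [phi [m [ps [okps H]]]] := @def_pred_definable _ 2 def_pred_leP.
exists phi, m, ps; split=> // s; rewrite -H /= !(tnth_nth vempty) /=.
split=> [ds|[] //]; split=> // i.
have [/domP_M M0 /domP_M M1] := leP_dom ds.
by case: i => -[|[|//]] lt_i; rewrite /elts /= (tnth_nth vempty).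
Qed.

(** * Extending partial maps *)

Definition padd (p i x : V) : V := vcup p (upair (opair i x) (opair i x)).

Lemma mem_padd p i x z : z ∈ padd p i x <-> z ∈ p \/ z = opair i x.
Proof. by rewrite mem_vcup V_pairing; split; tauto. Qed.

Lemma pfun_bound p : pfun p -> exists n, forall i x, opair i x ∈ p -> i ∈ num n.
Proof.
move=> [Mp [_ [_ _ [/mem_omega[n ->] nP]]]]; exists n => i x ix.
by have [Mi Mx] := M_opair_inv (trM Mp ix); apply: nP ix.
Qed.

Lemma pfun_uniq p i x y : pfun p -> opair i x ∈ p -> opair i y ∈ p -> x = y.
Proof.
move=> [Mp [fp _]] ix iy; have [Mi Mx] := M_opair_inv (trM Mp ix).
by have [_ My] := M_opair_inv (trM Mp iy); apply: fp ix iy.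
Qed.

Lemma pfun_empty : pfun vempty.
Proof.
split; first exact: M_empty.
split=> [i _ x _ y _ /V_empty //|].
exists vempty; first exact: M_empty.
by split=> [|i _ x _ /V_empty //]; apply/mem_omega; exists 0.
Qed.

Lemma pfun_padd p k x : pfun p -> x ∈ M -> (forall y, ~ opair (num k) y ∈ p) ->
  pfun (padd p (num k) x).
Proof.
move=> fp Mx kp; split.
  apply: M_vcup; first exact: pfun_M.
  by apply: M_upair; apply: M_opair => //; apply: M_num.
split=> [i _ y _ z _ /mem_padd[iy|/opair_inj[-> ->]] /mem_padd[iz|/opair_inj[E ->]] //|].
- exact: pfun_uniq iy iz.
- by case: (kp y); rewrite -E.
- by case: (kp z).
have [n nP] := pfun_bound fp; exists (num (maxn n k.+1)); first exact: M_num.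
split=> [|i _ y _]; first by apply/mem_omega; exists (maxn n k.+1).
move=> /mem_padd[/nP/mem_num[j lt_j ->]|/opair_inj[-> _]]; apply/mem_num.
  by exists j => //; rewrite leq_max lt_j.
by exists k => //; rewrite leq_max leqnn orbT.
Qed.

Lemma pfun_extend p k x : pfun p -> x ∈ M ->
  exists q y, [/\ pfun q, forall z, z ∈ p -> z ∈ q & opair (num k) y ∈ q] /\
    ((forall y, ~ opair (num k) y ∈ p) -> y = x).
Proof.
move=> fp Mx; have [[y ky]|kp] := pselect (exists y, opair (num k) y ∈ p).
  by exists p, y; split=> // /(_ y).
have kp' y : ~ opair (num k) y ∈ p by move=> ky; apply: kp; exists y.
exists (padd p (num k) x), x; split=> //; split; first exact: pfun_padd.
  by move=> z zp; apply/mem_padd; left.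
by apply/mem_padd; right.
Qed.

Lemma pfun_fresh p : pfun p -> exists k, forall y, ~ opair (num k) y ∈ p.
Proof.
move=> /pfun_bound[n nP]; exists n => y /nP; exact: mem_irrefl.
Qed.

(** For the diagonal argument: the parameters of a formula are stored from index 1 on, and index 0
    stays free for the argument of the formula. *)
Lemma pfun_prefix (h : nat -> V) m : (forall i, h i ∈ M) -> exists p, [/\ pfun p,
  forall i, i < m -> opair (num i.+1) (h i) ∈ p & forall y, ~ opair (num 0) y ∈ p].
Proof.
move=> Mh; suff [p [fp hp pP]] : exists p, [/\ pfun p,
    forall i, i < m -> opair (num i.+1) (h i) ∈ p &
    forall k y, opair (num k) y ∈ p -> 0 < k <= m].
  by exists p; split=> // y /pP.
elim: m => [|m [p [fp hp pP]]].
  by exists vempty; split=> // [|k y /V_empty //]; apply: pfun_empty.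
exists (padd p (num m.+1) (h m)); split.
- by apply: pfun_padd => // y /pP; rewrite ltnn.
- move=> i; rewrite ltnS leq_eqVlt => /orP[/eqP->|lt_i]; apply/mem_padd; first by right.
  by left; apply: hp.
- move=> k y /mem_padd[/pP/andP[-> le_k]|/opair_inj[/num_inj-> _]]; first exact: leqW.
  by rewrite /= leqnn.
Qed.

Lemma domP_A p : pfun p -> domP (fun_cond p).
Proof. by move=> fp; left; exists p => //; apply: pfun_M. Qed.

Lemma domP_B i j : i ∈ omega -> j ∈ omega -> domP (notin_cond i j).
Proof.
by move=> iw jw; right; exists i; [apply: (trM M_omega)|exists j => //; apply: (trM M_omega)].
Qed.

(** A map that sends both indices to the empty set lies below [notin_cond], because the empty set is
    not an element of itself. *)
Lemma dense_A z : domP z -> exists2 p, pfun p & leP (fun_cond p) z.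
Proof.
case=> [[p _ [fp ->]]|[_ _ [_ _ [/mem_omega[i ->] [/mem_omega[j ->] ->]]]]].
  by exists p => //; apply: leP_refl; apply: domP_A.
have M0 := M_empty; have iw : num i ∈ omega by apply/mem_omega; exists i.
have jw : num j ∈ omega by apply/mem_omega; exists j.
have [p [fp ip jp]] : exists p, [/\ pfun p, opair (num i) vempty ∈ p & opair (num j) vempty ∈ p].
  have fi : pfun (padd vempty (num i) vempty).
    by apply: pfun_padd => // [|y /V_empty //]; apply: pfun_empty.
  have [Eij|Nij] := eqVneq i j.
    by exists (padd vempty (num i) vempty); split=> //; apply/mem_padd; right; rewrite ?Eij.
  exists (padd (padd vempty (num i) vempty) (num j) vempty); split.
  - apply: pfun_padd => // y /mem_padd[/V_empty //|/opair_inj[/num_inj Eji _]].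
    by rewrite Eji eqxx in Nij.
  - by apply/mem_padd; left; apply/mem_padd; right.
  - by apply/mem_padd; right.
exists p => //; apply: leP_AB => //.
by exists vempty => //; exists vempty => //; do 2!split=> //; apply: V_empty.
Qed.

(** * The generic map from omega onto [M] *)

Definition cond_set (Q : V -> Prop) (z : V) : Prop :=
  exists2 q, q ∈ M & pfun q /\ Q q /\ z = fun_cond q.

(** This is the graph of the generic map f. *)
Definition interp (G : set V) (i x : V) : Prop :=
  exists p, [/\ pfun p, G (fun_cond p) & opair i x ∈ p].

Lemma interp_M G i x : interp G i x -> x ∈ M.
Proof. by move=> [p [[Mp _] _ /(trM Mp)/M_opair_inv[]]]. Qed.

Section Generic.
Variable G : set V.
Hypothesis genG : generic M collapse_poset G.

(** Density among the maps is enough, since by [dense_A] every condition has a map below it. *)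
Lemma generic_meets (Q : V -> Prop) : def_pred (fun s => Q (s 0)) ->
  (forall p, pfun p -> exists q, [/\ pfun q, forall x, x ∈ p -> x ∈ q & Q q]) ->
  exists p, [/\ pfun p, G (fun_cond p) & Q p].
Proof.
move=> dQ denseQ; have [_ meetsG] := genG.
have [||z Gz [p _ [fp [Qp E]]]] := meetsG (cond_set Q); last by exists p; rewrite -E.
  split=> [z [q _ [fq [_ ->]]]|z /dense_A[p fp pz]]; first exact: domP_A.
  have [q [fq pq Qq]] := denseQ p fp; exists (fun_cond q); first by exists q => //; apply: pfun_M.
  by apply: leP_trans pz; apply: leP_AA.
have M0 := M_empty; have Mw := M_omega.
have dD : def_pred (fun s => cond_set Q (s 0)).
  apply: (@def_pred_ex (fun q s => pfun q /\ Q q /\ s 0 = fun_cond q)).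
  by apply: def_pred_and; [rewrite /pfun|apply: def_pred_and => //; rewrite /fun_cond]; solve_def.
have [phi [m [ps [okps H]]]] := @def_pred_definable _ 1 dD.
exists phi, m, ps; split=> // s; rewrite -H /= /thead (tnth_nth vempty) /=.
split=> [ds|[] //]; split=> // i; rewrite (ord1 i) /elts /= (tnth_nth vempty) /=.
by case: ds => q Mq [_ [_ ->]]; apply: M_opair.
Qed.

Lemma generic_join z p : G z -> G (fun_cond p) ->
  exists q, [/\ pfun q, G (fun_cond q), leP (fun_cond q) z & forall x, x ∈ p -> x ∈ q].
Proof.
have [[_ _ _ Gdir] _] := genG; move=> Gz Gp; have [r [Gr /= rz rp]] := Gdir _ _ Gz Gp.
by have [q [fq Er pq]] := leP_A rp; subst r; exists q.
Qed.

(** The order has no greatest element, as nothing but [notin_cond i j] and maps lies below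
    [notin_cond i j], and no map lies above it. Still the empty map is in every generic filter, so
    it can be attached to those elements of a name that are always to be present. *)
Lemma generic_empty : G (fun_cond vempty).
Proof.
have [p fp|p [fp Gp _]] := @generic_meets (fun p => p = p) (def_pred_eqv 0 0).
  by exists p.
have [[_ _ Gup _] _] := genG; apply: Gup Gp _.
by apply: leP_AA => // [|x /V_empty //]; apply: pfun_empty.
Qed.

Lemma interp_total i : i ∈ omega -> exists x, interp G i x.
Proof.
move=> /mem_omega[k ->]; have M0 := M_empty; have Mk := M_num k.
have [||p [fp Gp [x _ kx]]] :=
    @generic_meets (fun p => exists2 x, x ∈ M & opair (num k) x ∈ p).
- by solve_def.
- move=> p fp; have [q [y [[fq pq ky] _]]] := pfun_extend k fp M0.
  exists q; split=> //; exists y => //.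
  by case: (M_opair_inv (trM (pfun_M fq) ky)).
by exists x, p.
Qed.

(** Domains are bounded, so each map leaves a fresh index at which [x] can be put as a value. *)
Lemma interp_surj x : x ∈ M -> exists2 i, i ∈ omega & interp G i x.
Proof.
move=> Mx; have Mw := M_omega.
have [||p [fp Gp [i _ [iw ix]]]] :=
    @generic_meets (fun p => exists2 i, i ∈ M & i ∈ omega /\ opair i x ∈ p).
- by solve_def.
- move=> p fp; have [k kp] := pfun_fresh fp.
  exists (padd p (num k) x); split; first exact: pfun_padd.
    by move=> z zp; apply/mem_padd; left.
  exists (num k); first exact: M_num.
  by split; [apply/mem_omega; exists k|apply/mem_padd; right].
by exists i => //; exists p.
Qed.

(** If the added condition is in G, then so is a map below it, and that map agrees with f.
    Conversely, a map in G extending both [p] and [q] lies below the added condition, and G is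
    closed upwards. *)
Lemma generic_B i j x y : i ∈ omega -> j ∈ omega -> interp G i x -> interp G j y ->
  (G (notin_cond i j) <-> ~ x ∈ y).
Proof.
move=> iw jw [p [fp Gp ix]] [q [fq Gq jy]].
have [[_ _ Gup _] _] := genG; split=> [GB|xy].
  have [r [fr Gr rB pr]] := generic_join GB Gp.
  have [t [ft Gt tr qt]] := generic_join Gr Gq.
  have [t' [_ /fun_cond_inj <- rt]] := leP_A tr.
  case: (leP_B rB) => [/fun_cond_neq //|[r' [_ /fun_cond_inj <- [u _ [v _ [iu [jv uv]]]]]]].
  rewrite (pfun_uniq fr (pr _ ix) iu).
  by rewrite (pfun_uniq ft (qt _ jy) (rt _ jv)).
have [r [fr Gr rp' qr]] := generic_join Gp Gq.
have [r' [_ /fun_cond_inj <- pr]] := leP_A rp'.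
apply: (Gup _ _ Gr); apply: leP_AB => //.
have Mx : x ∈ M by case: (M_opair_inv (trM (pfun_M fp) ix)).
have My : y ∈ M by case: (M_opair_inv (trM (pfun_M fq) jy)).
by exists x => //; exists y => //; split; [apply: pr|split => //; apply: qr].
Qed.

End Generic.

(** * Names for sets, pairs and ordered pairs *)

Definition name_of_set (S : V) : V := vimage S (fun tau => opair tau (fun_cond vempty)).

Lemma mem_name_of_set S z :
  z ∈ name_of_set S <-> exists2 tau, tau ∈ S & z = opair tau (fun_cond vempty).
Proof. exact: mem_vimage. Qed.

Lemma eval_name_of_set G S x : generic M collapse_poset G ->
  (x ∈ eval G (name_of_set S) <-> exists2 tau, tau ∈ S & x = eval G tau).
Proof.
move=> genG; rewrite mem_eval.
split=> [[tau [-> [p _ /mem_name_of_set[sg sgS /opair_inj[-> _]]]]]|].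
  by exists sg.
move=> [tau tauS ->]; exists tau; split=> //; exists (fun_cond vempty); first exact: generic_empty.
by apply/mem_name_of_set; exists tau.
Qed.

Lemma is_name_of_set S : (forall tau, tau ∈ S -> is_name collapse_poset tau) ->
  is_name collapse_poset (name_of_set S).
Proof.
move=> nS; constructor=> z /mem_name_of_set[tau tauS ->].
by exists tau, (fun_cond vempty); split=> //; [apply: nS|apply: domP_A; apply: pfun_empty].
Qed.

Lemma def_fun_name_of_set t : def_fun t -> def_fun (fun s => name_of_set (t s)).
Proof.
have M0 := M_empty; move=> dt; apply: (def_fun_vimage (t := fun x _ => opair x _)) => //.
by rewrite /fun_cond; solve_def.
Qed.

Lemma eval_empty G : eval G vempty = vempty.
Proof.
by apply: V_ext => x; rewrite mem_eval; split=> [[t [_ [p _ /V_empty]]]|/V_empty].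
Qed.

Lemma is_name_empty : is_name collapse_poset vempty.
Proof. by constructor=> z /V_empty. Qed.

Definition name_upair (sg tau : V) : V := name_of_set (upair sg tau).

Lemma eval_name_upair G sg tau : generic M collapse_poset G ->
  eval G (name_upair sg tau) = upair (eval G sg) (eval G tau).
Proof.
move=> genG; apply: V_ext => x; rewrite (eval_name_of_set _ _ genG) V_pairing.
split=> [[r /V_pairing[->|->] ->]|[->|->]]; [by left|by right|exists sg|exists tau] => //;
  by apply/V_pairing; auto.
Qed.

Lemma is_name_upair sg tau : is_name collapse_poset sg -> is_name collapse_poset tau ->
  is_name collapse_poset (name_upair sg tau).
Proof. by move=> nsg ntau; apply: is_name_of_set => r /V_pairing[->|->]. Qed.

Definition name_opair (sg tau : V) : V :=
  name_upair (name_upair sg sg) (name_upair sg tau).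

Lemma eval_name_opair G sg tau : generic M collapse_poset G ->
  eval G (name_opair sg tau) = opair (eval G sg) (eval G tau).
Proof. by move=> genG; rewrite !eval_name_upair. Qed.

Lemma is_name_opair sg tau : is_name collapse_poset sg -> is_name collapse_poset tau ->
  is_name collapse_poset (name_opair sg tau).
Proof. by move=> nsg ntau; do !apply: is_name_upair. Qed.

Lemma def_fun_name_opair t u : def_fun t -> def_fun u -> def_fun (fun s => name_opair (t s) (u s)).
Proof. by move=> dt du; do !(apply: def_fun_name_of_set; apply: def_fun_upair). Qed.

(** * Names with constant value, and names for truth values *)

Definition is_const (sg x : V) : Prop :=
  [/\ sg ∈ M, is_name collapse_poset sg & forall G, generic M collapse_poset G -> eval G sg = x].

Lemma is_const_empty : is_const vempty vempty.
Proof. by split; [apply: M_empty|apply: is_name_empty|move=> G _; apply: eval_empty]. Qed.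

Lemma M_name_of_set S : S ∈ M -> name_of_set S ∈ M.
Proof.
move=> MS; have M0 := M_empty.
by apply: (proj1 (def_fun_name_of_set (def_fun_cst MS)) (fun=> vempty)) => i.
Qed.

Lemma is_const_upair sg tau x y : is_const sg x -> is_const tau y ->
  is_const (name_upair sg tau) (upair x y).
Proof.
move=> [Msg nsg esg] [Mtau ntau etau]; split.
- by apply: M_name_of_set; apply: M_upair.
- exact: is_name_upair.
- by move=> G genG; rewrite eval_name_upair // esg // etau.
Qed.

Lemma is_const_opair sg tau x y : is_const sg x -> is_const tau y ->
  is_const (name_opair sg tau) (opair x y).
Proof. by move=> csg ctau; do !apply: is_const_upair. Qed.

(* The assignment e of variables to indices in omega is an argument of the name,
   definably so, in order that [named_ex] can collect the names over omega. *)
Definition named (R : env -> Prop) : Prop := exists T F sgT sgF (N : env -> V),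
  [/\ T <> F, is_const sgT T, is_const sgF F, def_fun N &
   forall e, (forall i, e i ∈ omega) -> is_name collapse_poset (N e) /\
     forall G a, generic M collapse_poset G -> (forall i, interp G (e i) (a i)) ->
       (R a -> eval G (N e) = T) /\ (~ R a -> eval G (N e) = F)].

Lemma named_equiv R R' : (forall s, in_M s -> (R s <-> R' s)) -> named R -> named R'.
Proof.
move=> RR' [T [F [sgT [sgF [N [TF cT cF dN H]]]]]]; exists T, F, sgT, sgF, N.
split=> // e ew; have [nN HN] := H e ew; split=> // G a genG ea.
have oka : in_M a by move=> i; apply: interp_M (ea i).
by have [RT RF] := HN G a genG ea; split=> Ra; [apply: RT|apply: RF]; rewrite RR'.
Qed.

Lemma named_not R : named R -> named (fun s => ~ R s).
Proof.
move=> [T [F [sgT [sgF [N [TF cT cF dN H]]]]]]; exists F, T, sgF, sgT, N.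
split=> // [/esym //|e ew]; have [nN HN] := H e ew; split=> // G a genG ea.
by have [RT RF] := HN G a genG ea; split=> // /contrapT.
Qed.

(** The name has the empty set as its only potential element, present exactly when [notin_cond] is
    in the filter. Its value is thus empty if f i is in f j and [one] otherwise. *)
Lemma named_mem i j : named (fun s => s i ∈ s j).
Proof.
have M0 := M_empty; have M1 := M_one.
pose N e := upair (opair vempty (notin_cond (e i) (e j))) (opair vempty (notin_cond (e i) (e j))).
exists vempty, one, vempty, (name_upair vempty vempty), N; split.
- exact: empty_neq_one.
- exact: is_const_empty.
- by apply: is_const_upair; apply: is_const_empty.
- by rewrite /N /notin_cond; solve_def.
move=> e ew; split.
  constructor=> z /V_pairing zE; exists vempty, (notin_cond (e i) (e j)).
  by split; [case: zE|apply: is_name_empty|apply: domP_B].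
move=> G a genG ea; have GB := generic_B genG (ew i) (ew j) (ea i) (ea j).
have evN x : x ∈ eval G (N e) <-> G (notin_cond (e i) (e j)) /\ x = vempty.
  rewrite mem_eval; split=> [[tau [-> [p Gp]]]|[GB' ->]].
    by rewrite V_pairing => -[] /opair_inj[-> <-]; rewrite eval_empty.
  exists vempty; rewrite eval_empty; split=> //; exists (notin_cond (e i) (e j)) => //.
  by apply/V_pairing; left.
split=> Ra; apply: V_ext => x; rewrite evN GB.
  by split=> [[]|/V_empty].
by rewrite V_pairing; split=> [[_ ->]|[]->]; [left|..].
Qed.

Definition quad (x y z t : V) : V := vcup (upair x y) (upair z t).

Lemma mem_quad u x y z t :
  u ∈ quad x y z t <-> [\/ u = x, u = y, u = z | u = t].
Proof.
rewrite mem_vcup !V_pairing; split=> [[[]|[]]|[]] ->;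
  by [constructor 1|constructor 2|constructor 3|constructor 4
     |left; left|left; right|right; left|right; right].
Qed.

(* The set of the four possible pairs of values tells whether (T, T') is
   attained when the other three pairs are put in by hand. *)
Lemma named_and R R' : named R -> named R' -> named (fun s => R s /\ R' s).
Proof.
move=> [T [F [sgT [sgF [N [TF cT cF dN H]]]]]].
move=> [T' [F' [sgT' [sgF' [N' [TF' cT' cF' dN' H']]]]]].
pose val x := quad x (opair T F') (opair F T') (opair F F').
pose nm sg := name_of_set
  (quad sg (name_opair sgT sgF') (name_opair sgF sgT') (name_opair sgF sgF')).
have cnm sg : sg ∈ M -> is_name collapse_poset sg -> [/\ nm sg ∈ M, is_name collapse_poset (nm sg) &
    forall G, generic M collapse_poset G -> eval G (nm sg) = val (eval G sg)].
  have [Mtf ntf etf] := is_const_opair cT cF'.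
  have [Mft nft eft] := is_const_opair cF cT'.
  have [Mff nff eff] := is_const_opair cF cF'.
  move=> Msg nsg; split.
  - by apply: M_name_of_set; apply: M_vcup; apply: M_upair.
  - by apply: is_name_of_set => tau /mem_quad[] ->.
  move=> G genG; apply: V_ext => x; rewrite (eval_name_of_set _ _ genG) mem_quad.
  rewrite -(etf G genG) -(eft G genG) -(eff G genG).
  split=> [[tau /mem_quad[] -> ->]|[] ->].
  - by constructor 1.
  - by constructor 2.
  - by constructor 3.
  - by constructor 4.
  - by exists sg => //; apply/mem_quad; constructor 1.
  - by exists (name_opair sgT sgF') => //; apply/mem_quad; constructor 2.
  - by exists (name_opair sgF sgT') => //; apply/mem_quad; constructor 3.
  - by exists (name_opair sgF sgF') => //; apply/mem_quad; constructor 4.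
have cval sg x : is_const sg x -> is_const (nm sg) (val x).
  move=> [Msg nsg esg]; have [Mn nn en] := cnm sg Msg nsg.
  by split=> // G genG; rewrite en // esg.
exists (val (opair T T')), (val (opair T F')), (nm (name_opair sgT sgT')),
  (nm (name_opair sgT sgF')), (fun e => nm (name_opair (N e) (N' e))); split.
- move=> E; have : opair T T' ∈ val (opair T F').
    by rewrite -E; apply/mem_quad; constructor 1.
  by move=> /mem_quad[] /opair_inj[].
- by apply: cval; apply: is_const_opair.
- by apply: cval; apply: is_const_opair.
- have [[MT _ _] [MF _ _]] := (cT, cF); have [[MT' _ _] [MF' _ _]] := (cT', cF').
  have dc x y : x ∈ M -> y ∈ M -> def_fun (fun=> name_opair x y).
    by move=> Mx My; apply: def_fun_name_opair; apply: def_fun_cst.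
  apply: def_fun_name_of_set; apply: def_fun_vcup; apply: def_fun_upair; try exact: dc.
  exact: def_fun_name_opair.
move=> e ew; have [nN HN] := H e ew; have [nN' HN'] := H' e ew.
have oke : in_M e by move=> i; apply: (trM M_omega).
have Mp : name_opair (N e) (N' e) ∈ M by apply: (proj1 (def_fun_name_opair dN dN')).
have [_ nn en] := cnm _ Mp (is_name_opair nN nN').
split=> // G a genG ea; rewrite en // eval_name_opair //.
have [RT RF] := HN G a genG ea; have [RT' RF'] := HN' G a genG ea.
split=> [[/RT-> /RT'->] //|nRR'].
have [Ra|nRa] := pselect (R a); have [Ra'|nRa'] := pselect (R' a).
- by case: nRR'.
- by rewrite RT // RF'.
- rewrite RF // RT' //; apply: V_ext => x; rewrite !mem_quad.
  by split=> -[] ->; by [constructor 1|constructor 2|constructor 3|constructor 4].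
- rewrite RF // RF' //; apply: V_ext => x; rewrite !mem_quad.
  by split=> -[] ->; by [constructor 1|constructor 2|constructor 3|constructor 4].
Qed.

(** Collect the values of the names for [R] over all indices n in omega, and throw in [F]. As f maps
    onto [M], the result contains [T] exactly if some x in [M] satisfies [R]; it is then the pair of
    [T] and [F], and otherwise the singleton of [F]. *)
Lemma named_ex R : named R -> named (fun s => exists2 x, x ∈ M & R (scons x s)).
Proof.
move=> [T [F [sgT [sgF [N [TF cT cF dN H]]]]]].
pose N' e := name_of_set (vcup (vimage omega (fun x => N (scons x e))) (upair sgF sgF)).
have [MF nF eF] := cF; have Mw := M_omega.
exists (upair T F), (upair F F), (name_upair sgT sgF), (name_upair sgF sgF), N'; split.
- by move=> /upair_inj[[]|[]].
- exact: is_const_upair.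
- exact: is_const_upair.
- apply: def_fun_name_of_set; apply: def_fun_vcup; last by solve_def.
  apply: (def_fun_vimage (t := fun x s => N (scons x s))); first exact: def_fun_cst.
  have -> : (fun s => N (scons (s 0) (shift s))) = N by apply/funext => s; rewrite scons_eta.
  by [].
move=> e ew; have ew' x : x ∈ omega -> forall i, scons x e i ∈ omega.
  by move=> xw [|i] //=.
split.
  apply: is_name_of_set => tau /mem_vcup[/mem_vimage[x xw ->]|/V_pairing[]-> //].
  by have [] := H _ (ew' x xw).
move=> G a genG ea.
have ea' n x : interp G n x -> forall i, interp G (scons n e i) (scons x a i).
  by move=> nx [|i] //=.
have valN n x : n ∈ omega -> interp G n x ->
    (R (scons x a) -> eval G (N (scons n e)) = T) /\
    (~ R (scons x a) -> eval G (N (scons n e)) = F).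
  by move=> nw nx; have [_ HN] := H _ (ew' n nw); apply: HN => //; apply: ea'.
have evN x : x ∈ eval G (N' e) <->
    (exists2 n, n ∈ omega & x = eval G (N (scons n e))) \/ x = F.
  rewrite (eval_name_of_set _ _ genG); split=> [[tau]|[[n nw ->]|->]].
  - move=> /mem_vcup[/mem_vimage[n nw ->] ->|/V_pairing[]-> ->]; last 2 first.
    + by right; apply: eF.
    + by right; apply: eF.
    by left; exists n.
  - exists (N (scons n e)) => //; apply/mem_vcup; left; apply/mem_vimage.
    by exists n.
  - exists sgF; last by rewrite eF.
    by apply/mem_vcup; right; apply/V_pairing; left.
split=> [[x Mx Rx]|nR]; apply: V_ext => y; rewrite evN V_pairing.
  split=> [[[n nw ->]|->]|[->|->]]; [|by right| |by right].
    have [z nz] := interp_total genG nw; have [VT VF] := valN n z nw nz.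
    by have [/VT|/VF] := pselect (R (scons z a)); [left|right].
  have [n nw nx] := interp_surj genG Mx; left; exists n => //.
  by have [VT _] := valN n x nw nx; rewrite VT.
split=> [[[n nw ->]|->]|[]->]; [|by left|by right|by right].
have [z nz] := interp_total genG nw; have [_ VF] := valN n z nw nz.
by left; apply: VF => Rz; apply: nR; exists z => //; apply: interp_M nz.
Qed.

Lemma named_satf phi : named (fun s => satf (elts M) s phi).
Proof.
elim: phi => [i j|i j|phi IH|phi IH psi IH'|phi IH] /=.
- exact: named_mem.
(* No condition speaks about equality directly. Extensionality in the transitive set [M] reduces it
   to membership, written with the available connectives only. *)
- apply: (@named_equiv (fun s => ~ exists2 x, x ∈ M &
     ~ (~ (x ∈ s i /\ ~ x ∈ s j) /\ ~ (x ∈ s j /\ ~ x ∈ s i)))).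
    move=> s oks; split=> [h|->]; last by move=> [x _]; tauto.
    apply: V_ext => x; split=> xs; apply: contrapT => xs'; apply: h; exists x; try tauto.
      exact: trM (oks i) xs.
    exact: trM (oks j) xs.
  apply: named_not.
  apply: (@named_ex (fun s => ~ (~ (s 0 ∈ s i.+1 /\ ~ s 0 ∈ s j.+1) /\
    ~ (s 0 ∈ s j.+1 /\ ~ s 0 ∈ s i.+1)))).
  by apply: named_not; apply: named_and; apply: named_not; apply: named_and;
    try apply: named_not; apply: named_mem.
- exact: named_not.
- exact: named_and.
- exact: (named_ex IH).
Qed.

(** * The diagonal argument *)

Lemma definability_lemma_fails :
  (forall p, domP p -> exists2 G, generic M collapse_poset G & G p) ->
  ~ definability_lemma M collapse_poset 2 (FEq 0 1).
Proof.
move=> exG def.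
(* Consider a map with c at index 0 and the parameters of a formula at the later indices. It forces
   the name of the formula to equal the name of [T] exactly if the formula holds at c, so a
   definable [R3] would be universal for definable classes. *)
pose R3 p sg tau := [/\ domP p, names M collapse_poset sg, names M collapse_poset tau &
  forall G, generic M collapse_poset G -> G p -> eval G sg = eval G tau].
have dR3 : def_pred (fun s => R3 (s 0) (s 1) (s 2)).
  apply: (definable_pred def) => s oks.
  set t := [tuple s i | i < 3].
  have tE : t = [:: s 0; s 1; s 2] :> seq V.
    apply: (@eq_from_nth _ vempty); rewrite size_tuple // => i lt_i.
    by rewrite nth_env_tuple //; case: i lt_i => [|[|[|]]].
  have t0 : thead t = s 0 by rewrite /thead (tnth_nth vempty) tE.
  have uE : [tuple of behead t] = [:: s 1; s 2] :> seq V by rewrite -[LHS]/(behead t) tE.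
  rewrite /R3 /forces t0; move: [tuple of behead t] uE => u uE; rewrite /= uE /=.
  split=> -[dp nsg].
    move=> ntau f; split=> // -[[|[|//]] lt_i]; by rewrite (tnth_nth vempty) /= uE.
  move=> f; split=> //.
    by have := nsg ord0; rewrite (tnth_nth vempty) /= uE.
  by have := nsg ord_max; rewrite (tnth_nth vempty) /= uE.
(* c codes the assignment p of parameters and the pair of names sg, tau for a
   formula; D is the diagonal class, variable 0 being sent to the index k. *)
pose D c := ~ exists2 p, p ∈ M & exists2 k, k ∈ M & exists2 sg, sg ∈ M &
  exists2 tau, tau ∈ M & c = opair p (opair k (opair sg tau)) /\ R3 (fun_cond (padd p k c)) sg tau.
have M0 := M_empty.
have dD : def_pred (fun s => D (s 0)).
  have dR3' t : def_fun t -> def_pred (fun s => R3 (t s) (s 1) (s 0)).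
    move=> dt; apply: (@def_pred_comp (fun x s => R3 x (s 1) (s 0))) => //.
    exact: (def_pred_ren (fun i => match i with 0 => 0 | 1 => 2 | _ => 1 end) dR3).
  rewrite /D; apply: def_pred_not; apply: (@def_pred_ex (fun p s => _)).
  do 3!apply: (@def_pred_ex (fun p s => _)).
  apply: def_pred_and; first by solve_def.
  by apply: dR3'; rewrite /fun_cond /padd; solve_def.
have okz : in_M (fun=> vempty) by [].
have [phi [m [ps [okps psP]]]] := def_pred_sat 1 dD okz.
have Mps i : nth vempty ps i ∈ M.
  have [lt_i|le_i] := ltnP i m; last by rewrite nth_default ?size_tuple.
  by have := okps (Ordinal lt_i); rewrite (tnth_nth vempty).
have [T [F [sgT [sgF [N [TF [MsgT nsgT esgT] _ dN H]]]]]] := named_satf phi.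
(* Variables beyond the m parameters are read as [vempty]. The map therefore takes one more value,
   the default [vempty] at index m + 1, and [e] sends all those variables to that index. *)
have [p0 [fp0 hp0 p00]] := pfun_prefix m.+1 Mps.
pose e i := num (minn i m.+1).
have ew i : e i ∈ omega by apply/mem_omega; exists (minn i m.+1).
have oke : in_M e by move=> i; apply: M_num.
have [nN HN] := H e ew.
have MN : N e ∈ M by apply: (proj1 dN).
(* The diagonal point codes the map and the names that come from the formula defining [D] itself. *)
pose c := opair p0 (opair (num 0) (opair (N e) sgT)).
have Mp0 := pfun_M fp0.
have Mc : c ∈ M by do !apply: M_opair => //; apply: (M_num 0).
pose q := padd p0 (num 0) c; have fq : pfun q by apply: pfun_padd.
have evN G : generic M collapse_poset G -> G (fun_cond q) ->
    (D c -> eval G (N e) = T) /\ (~ D c -> eval G (N e) = F).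
  move=> genG Gq.
  have DE : satf (elts M) (nth vempty (c :: ps)) phi <-> D c.
    by rewrite -sat_satf (psP [:: c]) // => -[].
  have := HN G (nth vempty (c :: ps)) genG; rewrite DE; apply=> i; exists q; split=> //.
  case: i => [|i]; apply/mem_padd; first by right; rewrite /e min0n.
  left; rewrite /e; have [lt_i|le_i] := ltnP i m.
    by rewrite (minn_idPl _) ?ltnS ?(ltnW lt_i) //; apply: hp0; apply: ltnW.
  rewrite (minn_idPr _) //= nth_default ?size_tuple // -(@nth_default _ vempty ps m) ?size_tuple //.
  exact: hp0.
have Dc : D c.
  (* If [D c] failed, its witnesses would be the components of [c]. A generic filter through [q]
     would then give [N e] both the value [T], as forced, and the value [F], as computed from the
     failure of [D c]. *)
  move=> W; have [p _ [k _ [sg _ [tau _ [E [_ _ _ f]]]]]] := W.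
  have [? /opair_inj[? /opair_inj[? ?]]] := opair_inj E; subst p k sg tau.
  have [G genG Gq] := exG _ (domP_A fq); have [_ VF] := evN G genG Gq.
  apply: TF; rewrite -(esgT G genG) -(f G genG Gq); by apply: VF => /(_ W).
(* Conversely, since [D c] holds, every generic filter through [q] evaluates [N e] to [T]. So [q]
   forces the equality, which is what [D c] denies. *)
apply: (Dc); exists p0 => //; exists (num 0); first exact: (M_num 0).
exists (N e) => //; exists sgT => //; split=> //; split=> //; first exact: domP_A.
by move=> G genG Gq; have [VT _] := evN G genG Gq; rewrite VT // esgT.
Qed.

End Definability.

(** * Existence of generic filters over a countable [M] *)

Fixpoint form_code (phi : form) : GenTree.tree nat :=
  match phi with
  | FMem i j => GenTree.Node 0 [:: GenTree.Leaf i; GenTree.Leaf j]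
  | FEq i j => GenTree.Node 1 [:: GenTree.Leaf i; GenTree.Leaf j]
  | FNot phi => GenTree.Node 2 [:: form_code phi]
  | FAnd phi psi => GenTree.Node 3 [:: form_code phi; form_code psi]
  | FEx phi => GenTree.Node 4 [:: form_code phi]
  end.

Lemma form_code_inj : injective form_code.
Proof.
elim=> [i j|i j|phi IH|phi IH psi IH'|phi IH] [i' j'|i' j'|phi'|phi' psi'|phi'] //= [].
- by move=> -> ->.
- by move=> -> ->.
- by move=> /IH->.
- by move=> /IH-> /IH'->.
- by move=> /IH->.
Qed.

(** A definable set is given by a formula and finitely many parameters. Formulae embed into finite
    trees over [nat], parameters into [nat] by countability, so such data are coded by natural
    numbers. *)
Lemma definable_sets_enum (M : V) : countable (elts M) ->
  exists S : nat -> set V, forall D, definable_set M D -> exists n, S n = D.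
Proof.
move=> /countable_injP[f f_inj].
(* [param] inverts the injection [f] on [M]; its values elsewhere do not matter. *)
have /choice[param paramP] (i : nat) : exists y, forall x, x ∈ M -> f x = i -> y = x.
  have [[x [Mx fx]]|nx] := pselect (exists x, x ∈ M /\ f x = i).
    by exists x => y My fy; apply: f_inj; rewrite ?fx //; apply/mem_set.
  by exists vempty => y My fy; case: nx; exists y.
pose sets (D : set V) (c : GenTree.tree nat * seq nat) := exists2 phi, form_code phi = c.1 &
  D = [set x | x ∈ M /\ sat (elts M) (x :: map param c.2) phi]%classic.
have sets_uniq D D' c : sets D c -> sets D' c -> D = D'.
  by move=> [phi E ->] [phi']; rewrite -E => /form_code_inj-> ->.
have /choice[S SP] (n : nat) :
    exists D', forall c D, unpickle n = Some c -> sets D c -> D' = D.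
  have [[c [D [nc Dc]]]|nD] :=
      pselect (exists c D, unpickle n = Some c /\ sets D c).
    by exists D => c' D'; rewrite nc => -[<-]; apply: sets_uniq.
  by exists set0 => c D nc Dc; case: nD; exists c, D.
exists S => D [phi [m [ps [okps H]]]].
exists (pickle (form_code phi, map f ps)).
apply: SP; first exact: pickleK.
exists phi => //; apply/funext => x; apply/propext.
  have -> : map param (map f ps) = ps.
    rewrite -map_comp; apply: (@eq_from_nth _ vempty); rewrite size_map // => i lt_i.
    rewrite (nth_map vempty) //=; apply: paramP => //.
    have := lt_i; rewrite size_tuple => lt_m.
    by have := okps (Ordinal lt_m); rewrite (tnth_nth vempty).
  have := H [tuple x]; rewrite (_ : thead [tuple x] = x) //= => ->.
  split=> [[/(_ ord0)]|[Mx]]; rewrite /elts /= ?(tnth_nth vempty) //; split=> // i.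
  by rewrite (ord1 i) (tnth_nth vempty).
Qed.

(** The Rasiowa-Sikorski construction: a descending sequence starts at [p] and enters the n-th
    definable set at step n + 1 whenever that set is dense; its upward closure is generic. *)
Lemma generic_exists (M : V) (P : poset) p : countable (elts M) -> dom P p ->
  exists2 G, generic M P G & G p.
Proof.
move=> /definable_sets_enum[S SP] dp.
have step (x : nat * {p | dom P p}) : exists q : {p | dom P p}, ple P (sval q) (sval x.2) /\
    (dense P (S x.1) -> S x.1 (sval q)).
  case: x => n [q dq] /=; have [dS|nS] := pselect (dense P (S n)).
    have [r Sr rq] := dS.2 q dq; exists (exist _ r (dS.1 r Sr)); split=> //.
  by exists (exist _ q dq); split=> //; apply: ple_refl.
have [next nextP] := choice step.
pose r := fix r n := if n is m.+1 then next (m, r m) else exist _ p dp.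
have r_dec m n : m <= n -> ple P (sval (r n)) (sval (r m)).
  elim: n => [|n IH]; first by rewrite leqn0 => /eqP->; apply: ple_refl; apply: svalP.
  rewrite leq_eqVlt => /orP[/eqP->|]; first by apply: ple_refl; apply: svalP.
  rewrite ltnS => /IH; apply: ple_trans; exact: (nextP (n, r n)).1.
exists (fun q => exists n, ple P (sval (r n)) q); last by exists 0; apply: ple_refl.
split; first split.
- by move=> q [n /ple_dom[]].
- by exists p, 0; apply: ple_refl.
- by move=> q q' [n nq] qq'; exists n; apply: ple_trans qq'.
- move=> q q' [n nq] [n' nq']; exists (sval (r (maxn n n'))); split.
  + by exists (maxn n n'); apply: ple_refl; apply: svalP.
  + by apply: ple_trans nq; apply: r_dec; apply: leq_maxl.
  + by apply: ple_trans nq'; apply: r_dec; apply: leq_maxr.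
move=> D dD /SP[n Sn]; subst D; exists (sval (r n.+1)).
  by exists n.+1; apply: ple_refl; apply: svalP.
exact: (nextP (n, r n)).2.
Qed.

Theorem theorem1p3 (M : V) (M_countable : countable (elts M))
    (M_transitive : transitive_set M) (M_ZFminus : ZFminus_model M) :
  exists P : poset, definable_poset M P /\
    exists (n : nat) (phi : form),
      [/\ atomic phi, fv_below n phi & ~ forcing_theorem M P n phi].
Proof.
exists (collapse_poset M_transitive M_ZFminus); split; first exact: collapse_poset_definable.
(* The half that fails is the definability lemma for equality. Countability of [M] supplies a
   generic filter through each condition. *)
exists 2, (FEq 0 1); split=> // -[def _].
apply: (definability_lemma_fails _ def) => p dp.
exact: generic_exists.
Qed.
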